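(* There exists an absolute constant $c>0$ such that the following holds. Let $d\ge 1$, let $\Gamma\subset\mathbb{Z}^d$ be finite and non-empty with $|\Gamma|=D$, and assume that $\Gamma$ is symmetric, i.e. $k\in\Gamma$ implies $-k\in\Gamma$. Let $x_1,\ldots,x_n$ be independent random variables uniformly distributed on $[0,1]^d$ and let $U$ be the random $n\times D$ matrix with entries $u_{tk}=e^{2\pi i k\cdot x_t}$, $t=1,\ldots,n$, $k\in\Gamma$. Let $0<\varepsilon<1$, $0<\delta<1$ and suppose $$n\ge\max\left\{D,\;c^{-1}\varepsilon^{-1}\ln\left(\frac{2}{\delta}\right)D\ln D,\;\left[c^{-1}\varepsilon^{-1}\ln\left(\frac{2}{\delta}\right)\right]^{2}\left(\sqrt{D}+\sqrt{D\ln D}\right)^{2}\right\}.$$ Then, with probability at least $1-\delta$, $$\left\Vert n^{-1}U^{*}U-Q\right\Vert<\varepsilon$$ and $$1-\varepsilon<\lambda_{\min}(n^{-1}U^{*}U)\le\lambda_{\max}(n^{-1}U^{*}U)<1+\varepsilon.$$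
   Context: For a matrix $A$, $A^{*}$ is its conjugate transpose, $\Vert A\Vert=\lambda_{\max}(A^{*}A)^{1/2}$ is the operator norm, and for hermitian $A$, $\lambda_{\max}(A)$, $\lambda_{\min}(A)$ are the largest and smallest eigenvalues. $Q:=\mathbb{E}[n^{-1}U^{*}U]$, which here is the $D\times D$ identity matrix. ''Absolute constant'' means that $c$ does not depend on $d,\Gamma,D,n,\varepsilon,\delta$. *)

(* Defs.v *)
From HB Require Import structures.
From mathcomp Require Export all_boot all_order all_algebra.
From mathcomp Require Export finmap.
From mathcomp Require Export all_classical all_reals all_analysis.
From mathcomp Require Export complex.

Set Implicit Arguments.
Unset Strict Implicit.
Unset Printing Implicit Defensive.

Import Order.TTheory GRing.Theory Num.Theory.
Import numFieldNormedType.Exports.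

Local Open Scope classical_set_scope.
Local Open Scope ring_scope.
Local Open Scope complex_scope.

Section HermitianMatrices.
Variable R : realType.

Definition adjoint (m n : nat) (A : 'M[R[i]]_(m, n)) : 'M[R[i]]_(n, m) :=
  map_mx Num.conj A^T.

(* The eigenvalues of a hermitian matrix are real and, for [0 < m], they form a
   finite non-empty set, so that [sup] and [inf] are a maximum and a minimum.
   Neither definition is meant to be used on a matrix which is not hermitian. *)
Definition eigenvalues (m : nat) (A : 'M[R[i]]_m) : set R :=
  [set a : R | eigenvalue A a%:C].

Definition lambda_max (m : nat) (A : 'M[R[i]]_m) : R := sup (eigenvalues A).

Definition lambda_min (m : nat) (A : 'M[R[i]]_m) : R := inf (eigenvalues A).

Definition opnorm (m n : nat) (A : 'M[R[i]]_(m, n)) : R :=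
  Num.sqrt (lambda_max (adjoint A *m A)).

End HermitianMatrices.

Section RandomVariables.
Context {R : realType} {dO : measure_display} {Omega : measurableType dO}.
Variable P : probability Omega R.

Definition mutually_independent (dE : measure_display) (E : measurableType dE)
    (n : nat) (X : 'I_n -> Omega -> E) : Prop :=
  forall (J : {set 'I_n}) (B : 'I_n -> set E),
    (forall t, measurable (B t)) ->
    P [set w | forall t, t \in J -> B t (X t w)] =
    (\prod_(t in J) P (X t @^-1` B t))%E.

(* The law of [X] is the [d]-fold product of the uniform probability on [0, 1],
   i.e. Lebesgue measure on [0, 1]^d: product measures are characterized by
   their values on measurable boxes, which generate the sigma-algebra of
   [d.-tuple R]. *)
Definition uniform_on_cube (d : nat) (X : Omega -> d.-tuple R) : Prop :=
  forall B : 'I_d -> set R, (forall i, measurable (B i)) ->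
    P [set w | forall i, B i (tnth (X w) i)] =
    (\prod_(i < d) uniform_prob (@ltr01 R) (B i))%E.

Definition expectation_mx (m n : nat) (A : Omega -> 'M[R[i]]_(m, n)) :
    'M[R[i]]_(m, n) :=
  \matrix_(i, j) (fine ('E_P[fun w => complex.Re (A w i j)]) +i*
                  fine ('E_P[fun w => complex.Im (A w i j)])).

End RandomVariables.

Section FourierMatrix.
Variable R : realType.

Definition dotp (d : nat) (k : 'rV[int]_d) (x : d.-tuple R) : R :=
  \sum_(i < d) (k 0 i)%:~R * tnth x i.

(* e^{2 pi i k.x} *)
Definition char_exp (d : nat) (k : 'rV[int]_d) (x : d.-tuple R) : R[i] :=
  cos (2 * pi * dotp k x) +i* sin (2 * pi * dotp k x).

(* The columns are numbered by the enumeration of [Gamma]; the choice of the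
   enumeration is irrelevant to norms and eigenvalues. *)
Definition fourier_mx (d n : nat) (Gamma : {fset 'rV[int]_d})
    (x : 'I_n -> d.-tuple R) : 'M[R[i]]_(n, #|` Gamma|) :=
  \matrix_(t < n, j < #|` Gamma|) char_exp (enum_fset Gamma)`_j (x t).

(* n^{-1} U^* U *)
Definition normalized_gram (d n : nat) (Gamma : {fset 'rV[int]_d})
    (x : 'I_n -> d.-tuple R) : 'M[R[i]]_(#|` Gamma|) :=
  let U := fourier_mx Gamma x in (n%:R)^-1 *: (adjoint U *m U).

End FourierMatrix.

(* Main.v *)
Require Import Defs.
From mathcomp Require Import measurable_realfun ring lra.

Import Order.TTheory GRing.Theory Num.Theory.
Import numFieldNormedType.Exports.
Local Open Scope classical_set_scope.
Local Open Scope fset_scope.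
Local Open Scope ring_scope.

Set Implicit Arguments.
Unset Strict Implicit.
Unset Printing Implicit Defensive.

(** Write [Y_t] for the rank-one matrix [u_t^* u_t] minus the identity, where
    [u_t] is the row [t] of [U], and [S] for the sum of the [Y_t], so that
    [n^{-1} U^* U - Q = n^{-1} S].  The proof bounds the moments [E tr S^{2p}].
    Expanding one factor, [tr S^{2p} = sum_t tr (Y_t S^{2p-1})], and subtracting
    the mean-zero terms [tr (Y_t (S - Y_t)^{2p-1})], one telescopes the difference
    of the two powers into traces [tr (Y_t S^q Y_t (S - Y_t)^{2p-2-q})].
    Diagonalising [S] and [S - Y_t] bounds their sum over [q] by
    [(2p-1)/2 tr (Y_t^2 (S^{2p-2} + (S - Y_t)^{2p-2}))], and the quadratic relation
    [Y_t^2 = (D-2) Y_t + (D-1)] turns this into the recursion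
    [E tr S^{2p} <= K E tr S^{2p-2}] with [K] of order [p^2 D^2 + p n D].  Markov's
    inequality with [p] of order [ln (2 D / delta)] concludes.  The only
    probabilistic input is that [E prod_t e(k_t . x_t)] vanishes unless all
    [k_t] are zero. *)

(** * Hermitian matrices *)

(** [S] and [Y_t] do not commute. Diagonalising [S] and [S - Y_t] separately turns the mixed traces
    into sums over pairs of real eigenvalues, with nonnegative weights independent of the exponents,
    so a scalar inequality applies pair by pair; an even total exponent lets the eigenvalues be
    replaced by absolute values. The quadratic relation leaves an odd moment with a coefficient of
    order [p D]. Completing the square trades it for half of [tr S^{2p}] and a multiple of order
    [p^2 D^2] of the preceding even moment: this is the first term of [K], while the second comes
    from the constants [D - 1] of the [n] summands. Removing [Y_t] changes the set of summands, so
    moments are bounded for all subsets of the indices at once. The matrix entries are trigonometric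
    polynomials, hence bounded, and independence enters by comparing frequencies. The sample size
    makes [K] at most [(n eps)^2 / 4]; a logarithmic [p] then absorbs both [delta] and the factor
    [D] coming from the trace of the identity. *)

Section HermitianTraces.
Context {R : realType}.
Local Notation C := R[i].

Definition is_hermitian n (A : 'M[C]_n) := adjoint A = A.

Lemma adjointM m n p (A : 'M[C]_(m, n)) (B : 'M[C]_(n, p)) :
  adjoint (A *m B) = adjoint B *m adjoint A.
Proof. by rewrite /adjoint trmx_mul map_mxM. Qed.

Lemma adjointK m n (A : 'M[C]_(m, n)) : adjoint (adjoint A) = A.
Proof. by apply/matrixP=> i j; rewrite !mxE conjCK. Qed.

Lemma is_hermitianB n (A B : 'M[C]_n) :
  is_hermitian A -> is_hermitian B -> is_hermitian (A - B).
Proof. by rewrite /is_hermitian /adjoint => hA hB; rewrite raddfB /= map_mxB hA hB. Qed.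

Lemma is_hermitianZ n (a : R) (A : 'M[C]_n) :
  is_hermitian A -> is_hermitian (a%:C%C *: A).
Proof.
move=> hA; apply/matrixP => i j; rewrite !mxE rmorphM -[in RHS]hA !mxE.
by congr (_ * _); exact: conjc_real.
Qed.

Lemma is_hermitian_sum n I (r : seq I) (p : pred I) (F : I -> 'M[C]_n) :
  (forall i, is_hermitian (F i)) -> is_hermitian (\sum_(i <- r | p i) F i).
Proof.
move=> hF; elim/big_rec: _ => [|i x _ hx].
  by rewrite /is_hermitian /adjoint trmx0 map_mx0.
by rewrite /is_hermitian /adjoint linearD /= map_mxD; congr (_ + _); [exact: hF|].
Qed.

Definition real_diag n (l : 'I_n -> R) : 'M[C]_n := diag_mx (\row_i (l i)%:C%C).

Lemma hermitian_diagonalization n (A : 'M[C]_n) : is_hermitian A ->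
  exists (V : 'M[C]_n) (l : 'I_n -> R),
    V *m adjoint V = 1%:M /\ A = adjoint V *m real_diag l *m V.
Proof.
move=> hA.
have herm : A \is hermsymmx.
  by apply/is_hermitianmxP; rewrite expr0 scale1r -[LHS]hA.
exists (spectralmx A), (fun i => complex.Re (spectral_diag A 0 i)); split.
  exact/unitarymxP/spectral_unitarymx.
have /orthomx_spectralP AE := hermitian_normalmx herm.
rewrite (invmx_unitary (spectral_unitarymx A)) in AE; apply: (etrans AE).
congr (_ *m _ *m _); rewrite /real_diag; congr diag_mx.
apply/matrixP => i j; rewrite !mxE ord1.
have /mxOverP /(_ 0 j) real_j := hermitian_spectral_diag_real herm.
by rewrite RRe_real.
Qed.

Lemma cReD (x y : C) : complex.Re (x + y) = complex.Re x + complex.Re y.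
Proof. by case: x; case: y. Qed.

Lemma cRe_sum I (r : seq I) (p : pred I) (F : I -> C) :
  complex.Re (\sum_(i <- r | p i) F i) = \sum_(i <- r | p i) complex.Re (F i).
Proof. by apply: (big_morph _ cReD). Qed.

Lemma Re_realM (a : R) (x : C) : complex.Re (a%:C%C * x) = a * complex.Re x.
Proof. by case: x => x y; rewrite /= mul0r subr0. Qed.

Lemma real_complex_sum I (r : seq I) (p : pred I) (F : I -> R) :
  (\sum_(i <- r | p i) F i)%:C%C = \sum_(i <- r | p i) (F i)%:C%C.
Proof. exact: rmorph_sum. Qed.

Lemma real_diagX n (l : 'I_n -> R) m :
  real_diag l ^+ m = real_diag (fun i => l i ^+ m).
Proof.
elim: m => [|m IH].
  apply/matrixP => i j; rewrite expr0 !mxE expr0.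
  by case: eqP => _; rewrite ?mulr1n ?mulr0n.
rewrite exprS IH -mulmxE mulmx_diag; congr diag_mx.
by apply/matrixP=> i j; rewrite !mxE exprS rmorphM.
Qed.

Lemma unitary_adjointK n (V : 'M[C]_n) :
  V *m adjoint V = 1%:M -> adjoint V *m V = 1%:M.
Proof. by move/mulmx1C. Qed.

Lemma diagonalizedX n (A V : 'M[C]_n) (l : 'I_n -> R) m :
  V *m adjoint V = 1%:M -> A = adjoint V *m real_diag l *m V ->
  A ^+ m = adjoint V *m real_diag (fun i => l i ^+ m) *m V.
Proof.
move=> VV ->; rewrite -real_diagX; elim: m => [|m IH].
  by rewrite !expr0 mulmx1 unitary_adjointK.
rewrite exprSr IH -mulmxE -!mulmxA (mulmxA V (adjoint V)) VV mul1mx.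
by rewrite [_ ^+ m.+1]exprSr -mulmxE !mulmxA.
Qed.

Lemma mxtrace_diagonalizedX n (A V : 'M[C]_n) (l : 'I_n -> R) m :
  V *m adjoint V = 1%:M -> A = adjoint V *m real_diag l *m V ->
  \tr (A ^+ m) = (\sum_i l i ^+ m)%:C%C.
Proof.
move=> VV AE; rewrite (diagonalizedX m VV AE) mxtrace_mulC mulmxA VV mul1mx.
by rewrite mxtrace_diag real_complex_sum; apply: eq_bigr => i _; rewrite mxE.
Qed.

(** [eigenvalue] concerns row eigenvectors: multiplying one by [adjoint V] gives an eigenvector of
    the diagonal matrix, and any nonzero coordinate of it identifies the eigenvalue. Conversely the
    rows of [V] are eigenvectors, nonzero since [V *m adjoint V] has ones on its diagonal. *)
Lemma eigenvalue_diagonalized n (A V : 'M[C]_n) (l : 'I_n -> R) (a : C) :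
  V *m adjoint V = 1%:M -> A = adjoint V *m real_diag l *m V ->
  eigenvalue A a <-> exists i, a = (l i)%:C%C.
Proof.
move=> VV AE; have V'V := unitary_adjointK VV.
have VA : V *m A = real_diag l *m V by rewrite AE !mulmxA VV mul1mx.
split.
  move/eigenvalueP => [v vA v0].
  pose u := v *m adjoint V.
  have u0 : u != 0.
    by apply: contra v0 => /eqP u0; rewrite -[v]mulmx1 -V'V mulmxA -/u u0 mul0mx.
  have ul : u *m real_diag l = a *: u.
    rewrite /u scalemxAl -vA AE !mulmxA -[RHS]mulmxA VV mulmx1.
    by [].
  clearbody u; have /rV0Pn [i ui] := u0.
  exists i; move/matrixP/(_ 0 i): ul.
  rewrite mul_mx_diag !mxE mulrC => /(mulIf ui).
  by move<-.
move=> [i ->]; apply/eigenvalueP; exists (row i V).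
  rewrite -row_mul VA; apply/matrixP => a' b.
  by rewrite /real_diag mul_diag_mx !mxE.
apply: contraTneq isT => Vi0.
have /matrixP/(_ i i) := VV.
rewrite [in LHS]mxE big1; first by rewrite !mxE eqxx => /eqP; rewrite eq_sym oner_eq0.
by move=> k _; move/matrixP/(_ 0 k): Vi0; rewrite !mxE => ->; rewrite mul0r.
Qed.

Lemma conjC_mul_self (z : C) :
  Num.conj z * z = (complex.Re z ^+ 2 + complex.Im z ^+ 2)%:C%C.
Proof. by rewrite mulrC -normCK add_Re2_Im2. Qed.

(** The trace equals that of [G^* diag(l^q) G diag(m^r)]. The weights [|G_ij|^2] are nonnegative and
    the same for all [q] and [r], so the noncommuting [A] and [B] are reduced to pairs of real
    numbers. *)
Lemma Re_mxtrace_sandwich n (H A B V W : 'M[C]_n) (l m : 'I_n -> R) q r :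
  is_hermitian H ->
  V *m adjoint V = 1%:M -> A = adjoint V *m real_diag l *m V ->
  W *m adjoint W = 1%:M -> B = adjoint W *m real_diag m *m W ->
  let G := V *m H *m adjoint W in
  complex.Re (\tr (H * A ^+ q * H * B ^+ r)) =
  \sum_j \sum_i (complex.Re (G i j) ^+ 2 + complex.Im (G i j) ^+ 2) *
                (l i ^+ q * m j ^+ r).
Proof.
move=> hH VV AE WW BE G.
have GE : adjoint G = W *m H *m adjoint V.
  by rewrite /G !adjointM adjointK hH mulmxA.
have -> : \tr (H * A ^+ q * H * B ^+ r) =
   \tr (adjoint G *m real_diag (fun i => l i ^+ q) *m G *m
        real_diag (fun i => m i ^+ r)).
  rewrite (diagonalizedX q VV AE) (diagonalizedX r WW BE) -!mulmxE.
  rewrite [in LHS]mulmxA mxtrace_mulC [in RHS]GE /G.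
  by rewrite !mulmxA.
rewrite /mxtrace cRe_sum; apply: eq_bigr => j _.
rewrite mul_mx_diag mxE mxE mulr_suml cRe_sum; apply: eq_bigr => i _.
rewrite mul_mx_diag !mxE.
set z := \sum_k _.
have -> : Num.conj z * (l i ^+ q)%:C%C * z * (m j ^+ r)%:C%C =
    (l i ^+ q * m j ^+ r)%:C%C * (Num.conj z * z) by rewrite rmorphM /=; ring.
by rewrite conjC_mul_self Re_realM mulrC.
Qed.


(** The even exponent allows passing to absolute values [a], [b]. The terms [q] and [2p - q] are
    then paired, and [(a^m - b^m)(a^q - b^q) >= 0] bounds each pair by [a^(2p) + b^(2p)]. *)
Lemma sum_mixed_powers_le (x y : R) p :
  \sum_(q < (p.*2).+1) x ^+ q * y ^+ (p.*2 - q) <=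
  (p.*2).+1%:R / 2 * (x ^+ p.*2 + y ^+ p.*2).
Proof.
have norm2 z : z ^+ p.*2 = `|z| ^+ p.*2 :> R.
  by rewrite -mul2n !exprM real_normK ?num_real.
apply: (@le_trans _ _ (\sum_(q < (p.*2).+1) `|x| ^+ q * `|y| ^+ (p.*2 - q))).
  by apply: ler_sum => q _; rewrite (le_trans (ler_norm _)) // normrM !normrX.
rewrite (norm2 x) (norm2 y).
have := normr_ge0 x; have := normr_ge0 y.
move: `|x| `|y| => {norm2}a b b0 a0.
set S := \sum_(q < _) _; set T := a ^+ _ + b ^+ _.
have SE : S = \sum_(q < (p.*2).+1) a ^+ (p.*2 - q) * b ^+ q.
  rewrite /S (reindex_inj rev_ord_inj) /=; apply: eq_bigr => q _.
  by rewrite subSS subKn // -ltnS.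
have two_terms q m : a ^+ q * b ^+ m + a ^+ m * b ^+ q <= a ^+ (m + q) + b ^+ (m + q).
  rewrite !exprD -subr_ge0.
  have -> : a ^+ m * a ^+ q + b ^+ m * b ^+ q - (a ^+ q * b ^+ m + a ^+ m * b ^+ q)
    = (a ^+ m - b ^+ m) * (a ^+ q - b ^+ q) by ring.
  by case: (leP a b) => ab; [rewrite -mulrNN !opprB|];
    rewrite mulr_ge0 // subr_ge0 lerXn2r ?nnegrE // ltW.
(* Adding the sum to its reversal gives one pair for each of the [2p+1] indices, hence the factor
   [(2p+1)/2]. *)
suff : S + S <= (p.*2).+1%:R * T by move=> ?; lra.
rewrite {2}SE /S -big_split /= -[(p.*2).+1 in leRHS]card_ord -sum1_card natr_sum.
rewrite mulr_suml; apply: ler_sum => q _; rewrite mul1r /T.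
have qp : (q <= p.*2)%N by rewrite -ltnS.
by have := two_terms q (p.*2 - q)%N; rewrite subnK.
Qed.

Lemma sum_mxtrace_sandwich_le n (H A B : 'M[C]_n) p :
  is_hermitian H -> is_hermitian A -> is_hermitian B ->
  \sum_(q < (p.*2).+1) complex.Re (\tr (H * A ^+ q * H * B ^+ (p.*2 - q))) <=
  (p.*2).+1%:R / 2 *
  (complex.Re (\tr (H * A ^+ p.*2 * H)) + complex.Re (\tr (H * H * B ^+ p.*2))).
Proof.
move=> hH /hermitian_diagonalization [V [l [VV AE]]].
move=> /hermitian_diagonalization [W [m [WW BE]]].
have tE q r := Re_mxtrace_sandwich q r hH VV AE WW BE.
(* Zeroth powers bring both bounding traces into the form of [Re_mxtrace_sandwich], with the same
   weights. *)
have -> : H * A ^+ p.*2 * H = H * A ^+ p.*2 * H * B ^+ 0 by rewrite expr0 mulr1.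
have -> : H * H * B ^+ p.*2 = H * A ^+ 0 * H * B ^+ p.*2 by rewrite expr0 mulr1.
under eq_bigr do rewrite tE.
rewrite !tE exchange_big /= -big_split /= mulr_sumr; apply: ler_sum => j _.
rewrite exchange_big /= -big_split /= mulr_sumr; apply: ler_sum => i _.
rewrite -mulr_sumr -mulrDr mulrCA ler_wpM2l ?addr_ge0 ?sqr_ge0 //.
by rewrite !expr0 mulr1 mul1r sum_mixed_powers_le.
Qed.

(** Powers of [A] stay on the left and powers of [B] on the right: with [A := S] and [B := S - Y_t],
    multiplication by [Y_t] gives exactly the traces of [sum_mxtrace_sandwich_le]. *)
Lemma subrXX_noncomm n (A B : 'M[C]_n) m :
  A ^+ m.+1 - B ^+ m.+1 = \sum_(q < m.+1) A ^+ q * (A - B) * B ^+ (m - q).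
Proof.
elim: m => [|m IH]; first by rewrite big_ord1 !expr0 mul1r mulr1 !expr1.
rewrite big_ord_recr /= subnn expr0 mulr1.
have -> : \sum_(q < m.+1) A ^+ q * (A - B) * B ^+ (m.+1 - q) =
   (A ^+ m.+1 - B ^+ m.+1) * B.
  rewrite IH mulr_suml; apply: eq_bigr => q _.
  by rewrite subSn -1?ltnS // exprSr !mulrA.
by rewrite mulrBr mulrBl -!exprSr addrC addrA subrK.
Qed.

Lemma mxtrace_even_ge0 n (A : 'M[C]_n) p : is_hermitian A ->
  0 <= complex.Re (\tr (A ^+ p.*2)).
Proof.
move=> /hermitian_diagonalization [V [l [VV AE]]].
rewrite (mxtrace_diagonalizedX p.*2 VV AE) /=; apply: sumr_ge0 => i _.
by rewrite -mul2n exprM exprn_ge0 // sqr_ge0.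
Qed.

(** The difference of the two sides is a sum of terms [(l_i - b)^2 l_i^(2p)], whatever the sign of
    [b]. This removes the odd moment created by the quadratic relation. *)
Lemma mxtrace_odd_le n (A : 'M[C]_n) p (b : R) : is_hermitian A ->
  2 * b * complex.Re (\tr (A ^+ p.*2.+1)) <=
  complex.Re (\tr (A ^+ p.+1.*2)) + b ^+ 2 * complex.Re (\tr (A ^+ p.*2)).
Proof.
move=> /hermitian_diagonalization [V [l [VV AE]]].
rewrite !(mxtrace_diagonalizedX _ VV AE) /= !mulr_sumr -big_split /=.
apply: ler_sum => i _; rewrite -subr_ge0 doubleS !(exprS (l i)).
set z := l i ^+ _; have z0 : 0 <= z by rewrite /z -mul2n exprM exprn_ge0 // sqr_ge0.
have -> : l i * (l i * z) + b ^+ 2 * z - 2 * b * (l i * z) = (l i - b) ^+ 2 * z by ring.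
by rewrite mulr_ge0 ?sqr_ge0.
Qed.

End HermitianTraces.

(** * Trace powers, extreme eigenvalues and the operator norm *)

Section Eigenvalues.
Context {R : realType}.
Local Notation C := R[i].

Lemma eigenvalues_diagonalized n (A V : 'M[C]_n) (l : 'I_n -> R) :
  V *m adjoint V = 1%:M -> A = adjoint V *m real_diag l *m V ->
  eigenvalues A = range l.
Proof.
move=> VV AE; apply/seteqP; split => a /=.
  by move/(eigenvalue_diagonalized _ VV AE) => [i /complexI ->]; exists i.
by move=> [i _ <-]; apply/(eigenvalue_diagonalized _ VV AE); exists i.
Qed.

Lemma sup_range_lt n (l : 'I_n.+1 -> R) c : (forall i, l i < c) -> sup (range l) < c.
Proof.
move=> lc; pose j := [arg max_(i > ord0) l i]%O.
apply: (@le_lt_trans _ _ (l j)) (lc j).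
apply: ge_sup; first by exists (l ord0), ord0.
by move=> _ [i _ <-]; rewrite /j; case: arg_maxP => // k _; exact.
Qed.

Lemma inf_range_gt n (l : 'I_n.+1 -> R) c : (forall i, c < l i) -> c < inf (range l).
Proof.
move=> lc; pose j := [arg min_(i < ord0) l i]%O.
apply: (@lt_le_trans _ _ (l j)) (lc j) _.
apply: lb_le_inf; first by exists (l ord0), ord0.
by move=> _ [i _ <-]; rewrite /j; case: arg_minP => // k _; exact.
Qed.

Lemma ubound_range n (l : 'I_n.+1 -> R) : has_ubound (range l).
Proof.
exists (l [arg max_(i > ord0) l i]%O) => _ [i _ <-].
by case: arg_maxP => // k _; exact.
Qed.

Lemma lbound_range n (l : 'I_n.+1 -> R) : has_lbound (range l).
Proof.
exists (l [arg min_(i < ord0) l i]%O) => _ [i _ <-].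
by case: arg_minP => // k _; exact.
Qed.

Lemma diagonalized_sqr n (A V : 'M[C]_n) (l : 'I_n -> R) :
  V *m adjoint V = 1%:M -> A = adjoint V *m real_diag l *m V ->
  is_hermitian A ->
  adjoint A *m A = adjoint V *m real_diag (fun i => l i ^+ 2) *m V.
Proof. by move=> VV AE ->; rewrite -(diagonalizedX 2 VV AE) expr2 mulmxE. Qed.

(** The trace is a sum of nonnegative even powers, so each single eigenvalue satisfies [|l_i| < e];
    adding the identity shifts the eigenvalues by one. *)
Lemma spectrum_near1 n (A : 'M[C]_n) (e : R) p : (0 < n)%N -> is_hermitian A -> 0 < e ->
  complex.Re (\tr (A ^+ p.+1.*2)) < e ^+ p.+1.*2 ->
  [/\ opnorm A < e, 1 - e < lambda_min (A + 1%:M),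
      lambda_min (A + 1%:M) <= lambda_max (A + 1%:M) & lambda_max (A + 1%:M) < 1 + e].
Proof.
case: n A => // n A _ hA e0; have [V [l [VV AE]]] := hermitian_diagonalization hA.
rewrite (mxtrace_diagonalizedX _ VV AE) /= => trA.
have le i : `|l i| < e.
  rewrite -(@ltr_pXn2r _ p.+1.*2) ?nnegrE ?normr_ge0 ?(ltW e0) //.
  apply: le_lt_trans trA; rewrite (bigD1 i) //= -[leLHS]addr0.
  have even_ge0 j : 0 <= l j ^+ p.+1.*2 by rewrite -mul2n exprM exprn_ge0 ?sqr_ge0.
  by rewrite -normrX ger0_norm // lerD2l sumr_ge0.
have BE : A + 1%:M = adjoint V *m real_diag (fun i => l i + 1) *m V.
  rewrite [in LHS]AE -(unitary_adjointK VV) -[X in _ + X *m V]mulmx1 -mulmxDl -mulmxDr.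
  congr (_ *m _ *m _); apply/matrixP => a b; rewrite !mxE.
  by case: eqP; rewrite ?mulr1n ?mulr0n ?addr0 // rmorphD.
rewrite /lambda_min /lambda_max (eigenvalues_diagonalized VV BE); split.
- rewrite /opnorm /lambda_max.
  rewrite (eigenvalues_diagonalized VV (diagonalized_sqr VV AE hA)).
  rewrite -[ltRHS](ger0_norm (ltW e0)) -sqrtr_sqr ltr_sqrt ?exprn_gt0 //.
  apply: sup_range_lt => i.
  by rewrite -real_normK ?num_real // ltr_pXn2r ?nnegrE ?normr_ge0 ?(ltW e0).
- by apply: inf_range_gt => i; move: (le i); rewrite ltr_norml => /andP[? ?]; lra.
- have r0 : range (fun i => l i + 1) (l ord0 + 1) by exists ord0.
  apply: (le_trans (ge_inf (lbound_range _) r0)).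
  exact: ub_le_sup (ubound_range _) _ r0.
- by apply: sup_range_lt => i; move: (le i); rewrite ltr_norml => /andP[? ?]; lra.
Qed.

(** The trace is at most [n s^(p+1)], where [s < e^2] is the largest squared eigenvalue, and
    [n (s / e^2)^(p+1)] tends to zero. As a converse to [spectrum_near1] it turns an event about
    eigenvalues into a countable union of events about traces. *)
Lemma mxtrace_pow_lt_of_opnorm n (A : 'M[C]_n) (e : R) :
  (0 < n)%N -> is_hermitian A -> 0 < e ->
  opnorm A < e -> exists p, complex.Re (\tr (A ^+ p.+1.*2)) < e ^+ p.+1.*2.
Proof.
case: n A => // n A _ hA e0; have [V [l [VV AE]]] := hermitian_diagonalization hA.
rewrite /opnorm /lambda_max (eigenvalues_diagonalized VV (diagonalized_sqr VV AE hA)).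
set s := sup _; move=> se.
have s0 : 0 <= s.
  by apply: le_trans (ub_le_sup (ubound_range _) (ex_intro2 _ _ ord0 I erefl)); rewrite sqr_ge0.
have ls i : l i ^+ 2 <= s.
  by apply: ub_le_sup (ubound_range _) _ _; exists i.
have se2 : s < e ^+ 2.
  by rewrite -ltr_sqrt ?exprn_gt0 // sqrtr_sqr (ger0_norm (ltW e0)).
have z1 : `|s / e ^+ 2| < 1.
  by rewrite ger0_norm ?divr_ge0 ?sqr_ge0 // ltr_pdivrMr ?exprn_gt0 // mul1r.
(* The limit is used at [N.+1] because the exponents of the conclusion start from [p.+1] with
   [p = 0]. *)
have /cvgrPdist_lt /(_ 1 ltr01) [N _ /(_ N.+1 (leqnSn N))] := cvg_geometric (n.+1%:R : R) z1.
rewrite /geometric /= sub0r normrN ger0_norm; last first.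
  by rewrite mulr_ge0 // exprn_ge0 // divr_ge0 ?sqr_ge0.
rewrite expr_div_n mulrA ltr_pdivrMr ?exprn_gt0 ?exprn_gt0 // mul1r => hN.
exists N; rewrite (mxtrace_diagonalizedX _ VV AE) /= -mul2n (exprM e).
apply: le_lt_trans hN; rewrite -[n.+1 in leRHS]card_ord -sum1_card natr_sum mulr_suml.
by apply: ler_sum => i _; rewrite mul1r exprM lerXn2r ?nnegrE ?sqr_ge0.
Qed.

End Eigenvalues.

(** In the application [u], [v], [w] are the traces of [S] to the powers [2p+2], [2p+1], [2p]. The
    odd term costs half of [u], which is why the left side keeps only [u / 2]. *)
Lemma absorb_odd_moment (R : realFieldType) (c alpha beta j u v w s1 s2 s3 s4 : R) :
  u = s2 + s1 ->
  2 * (c * alpha) * v <= u + (c * alpha) ^+ 2 * w ->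
  s1 <= c * (alpha * v + j * beta * w + (alpha * s3 + beta * s4)) ->
  u / 2 <= s2 + c * alpha * s3 + ((c * alpha) ^+ 2 / 2 + c * (j * beta)) * w +
           c * beta * s4.
Proof. by move=> -> h1 h2; lra. Qed.

(** * One step of the moment recursion, before taking expectations *)

Section TraceRecursion.
Local Open Scope complex_scope.
Context {R : realType} {I : finType} {D : nat}.
Local Notation C := R[i].
Variable Y : I -> 'M[C]_D.
Variables alpha beta : R.
Hypothesis hY : forall i, is_hermitian (Y i).
Hypothesis Y2 : forall i, Y i * Y i = alpha%:C *: Y i + (beta%:C)%:M.

Definition retr (A : 'M[C]_D) : R := complex.Re (\tr A).

Lemma retrD A B : retr (A + B) = retr A + retr B.
Proof. by rewrite /retr mxtraceD cReD. Qed.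

Lemma retrZ (a : R) A : retr (a%:C *: A) = a * retr A.
Proof. by rewrite /retr mxtraceZ Re_realM. Qed.

Lemma retr_sum K (r : seq K) (p : pred K) (F : K -> 'M[C]_D) :
  retr (\sum_(i <- r | p i) F i) = \sum_(i <- r | p i) retr (F i).
Proof. by apply: (big_morph _ retrD); rewrite /retr mxtrace0. Qed.

Lemma retrC A B : retr (A * B) = retr (B * A).
Proof. by rewrite /retr -!mulmxE mxtrace_mulC. Qed.

(** Indexing by subsets keeps [S - Y_i] in the same family as [S]. *)
Definition partial_sum (J : {set I}) : 'M[C]_D := \sum_(i in J) Y i.

Lemma is_hermitian_partial_sum J : is_hermitian (partial_sum J).
Proof. exact: is_hermitian_sum. Qed.

(** Sums with a single [Y i] next to a power of [partial_sum (J :\ i)] are kept as they stand, since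
    they have mean zero once the [Y i] are independent and centred; everything else is bounded by
    even powers. *)
Lemma trace_recursion (J : {set I}) p (S := partial_sum J) (c := (p.*2.+1)%:R / 2) :
  retr (S ^+ p.+1.*2) / 2 <=
    \sum_(i in J) retr (Y i * partial_sum (J :\ i) ^+ p.*2.+1) +
    c * alpha * \sum_(i in J) retr (Y i * partial_sum (J :\ i) ^+ p.*2) +
    ((c * alpha) ^+ 2 / 2 + c * (#|J|%:R * beta)) * retr (S ^+ p.*2) +
    c * beta * \sum_(i in J) retr (partial_sum (J :\ i) ^+ p.*2).
Proof.
pose Si i := partial_sum (J :\ i).
have SB i : i \in J -> S - Si i = Y i.
  by move=> iJ; rewrite /S /Si /partial_sum (big_setD1 i) //= addrK.
have c0 : 0 <= c by rewrite /c divr_ge0.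
have expand : retr (S ^+ p.+1.*2) =
    \sum_(i in J) retr (Y i * Si i ^+ p.*2.+1) +
    \sum_(i in J) \sum_(q < p.*2.+1) retr (Y i * S ^+ q * Y i * Si i ^+ (p.*2 - q)).
  rewrite doubleS exprS {1}/S /partial_sum mulr_suml retr_sum -big_split /=.
  apply: eq_bigr => i iJ.
  rewrite -{1}[S ^+ _](subrK (Si i ^+ p.*2.+1)) mulrDr retrD addrC; congr (_ + _).
  rewrite subrXX_noncomm mulr_sumr retr_sum; apply: eq_bigr => q _.
  by rewrite SB // !mulrA.
have sandwich i : \sum_(q < p.*2.+1) retr (Y i * S ^+ q * Y i * Si i ^+ (p.*2 - q)) <=
    c * (retr (Y i * Y i * S ^+ p.*2) + retr (Y i * Y i * Si i ^+ p.*2)).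
  have -> : retr (Y i * Y i * S ^+ p.*2) = retr (Y i * S ^+ p.*2 * Y i).
    by rewrite -[X in retr X]mulrA; exact: retrC.
  by apply: sum_mxtrace_sandwich_le => //; exact: is_hermitian_partial_sum.
have square i A : retr (Y i * Y i * A) = alpha * retr (Y i * A) + beta * retr A.
  by rewrite Y2 -mulmxE mulmxDl -scalemxAl mul_scalar_mx retrD !retrZ.
have sumS : \sum_(i in J) retr (Y i * Y i * S ^+ p.*2) =
    alpha * retr (S ^+ p.*2.+1) + #|J|%:R * beta * retr (S ^+ p.*2).
  under eq_bigr do rewrite square.
  rewrite big_split /= -mulr_sumr -retr_sum -mulr_suml -/(partial_sum J) -exprS.
  by rewrite sumr_const -mulrA mulr_natl.
have sumSi : \sum_(i in J) retr (Y i * Y i * Si i ^+ p.*2) =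
    alpha * (\sum_(i in J) retr (Y i * Si i ^+ p.*2)) +
    beta * (\sum_(i in J) retr (Si i ^+ p.*2)).
  by under eq_bigr do rewrite square; rewrite big_split /= -!mulr_sumr.
(* The parameter [c * alpha] is the coefficient of the odd trace in [bound], so that trace is
   absorbed entirely. *)
have odd_bound := mxtrace_odd_le p (c * alpha) (is_hermitian_partial_sum J).
rewrite -/S -!/(retr _) in odd_bound.
have bound : \sum_(i in J) \sum_(q < p.*2.+1) retr (Y i * S ^+ q * Y i * Si i ^+ (p.*2 - q)) <=
    c * (alpha * retr (S ^+ p.*2.+1) + #|J|%:R * beta * retr (S ^+ p.*2) +
      (alpha * (\sum_(i in J) retr (Y i * Si i ^+ p.*2)) +
       beta * (\sum_(i in J) retr (Si i ^+ p.*2)))).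
  by rewrite -sumS -sumSi -big_split mulr_sumr; apply: ler_sum => i _; exact: sandwich.
exact: absorb_odd_moment expand odd_bound bound.
Qed.

End TraceRecursion.

(** * Independence and expectations of bounded functions *)

Section BoundedMeasurable.
Context {R : realType} {d : measure_display} {T : measurableType d}.

(** On a probability space such functions are integrable and closed under products, so expectations
    can be computed without separate integrability conditions. *)
Definition bounded_measurable (f : T -> R) :=
  measurable_fun setT f /\ exists M, forall x, `|f x| <= M.

Lemma bounded_measurable_cst (a : R) : bounded_measurable (fun=> a).
Proof. by split; [exact: measurable_cst | exists `|a|]. Qed.

Lemma bounded_measurableD f g : bounded_measurable f -> bounded_measurable g ->
  bounded_measurable (fun x => f x + g x).
Proof.
move=> [mf [M fM]] [mg [N gN]]; split; first exact: measurable_funD.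
by exists (M + N) => x; rewrite (le_trans (ler_normD _ _)) // lerD.
Qed.

Lemma bounded_measurableM f g : bounded_measurable f -> bounded_measurable g ->
  bounded_measurable (fun x => f x * g x).
Proof.
move=> [mf [M fM]] [mg [N gN]]; split; first exact: measurable_funM.
by exists (M * N) => x; rewrite normrM ler_pM.
Qed.

Lemma bounded_measurableN f : bounded_measurable f ->
  bounded_measurable (fun x => - f x).
Proof.
move=> [mf [M fM]]; split; first exact: measurableT_comp.
by exists M => x; rewrite normrN.
Qed.

Lemma bounded_measurableB f g : bounded_measurable f -> bounded_measurable g ->
  bounded_measurable (fun x => f x - g x).
Proof. by move=> bf bg; exact/bounded_measurableD/bounded_measurableN. Qed.

Lemma bounded_measurable_sum I (r : seq I) (F : I -> T -> R) :
  (forall i, bounded_measurable (F i)) ->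
  bounded_measurable (fun x => \sum_(i <- r) F i x).
Proof.
move=> bF; elim: r => [|i r IH].
  by under eq_fun do rewrite big_nil; exact: bounded_measurable_cst.
by under eq_fun do rewrite big_cons; exact: bounded_measurableD.
Qed.

Lemma bounded_measurable_indic (A : set T) : measurable A ->
  bounded_measurable (\1_A : T -> R).
Proof.
move=> mA; split; first exact: measurable_indic.
by exists 1 => x; rewrite indicE; case: (_ \in _); rewrite ?normr1 ?normr0.
Qed.

Lemma bounded_measurable_comp d' (T' : measurableType d') (X : T -> T') (f : T' -> R) :
  measurable_fun setT X ->
  measurable_fun setT f -> (exists M, forall x, `|f x| <= M) ->
  bounded_measurable (fun x => f (X x)).
Proof.
move=> mX mf [M fM]; split; first exact: measurableT_comp.
by exists M.
Qed.

Variable P : probability T R.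

Lemma bounded_measurable_integrable f : bounded_measurable f ->
  P.-integrable setT (EFin \o f).
Proof.
move=> [mf [M fM]]; apply: measurable_bounded_integrable => //.
  by apply: le_lt_trans (probability_le1 P measurableT) _; rewrite ltry.
by exists M; split; [exact: num_real | move=> N MN x _; exact: le_trans (ltW MN)].
Qed.

Lemma RintegralD_bounded f g : bounded_measurable f -> bounded_measurable g ->
  \int[P]_x (f x + g x) = \int[P]_x f x + \int[P]_x g x.
Proof. by move=> bf bg; rewrite RintegralD //; exact: bounded_measurable_integrable. Qed.

Lemma RintegralZ_bounded a f : bounded_measurable f ->
  \int[P]_x (a * f x) = a * \int[P]_x f x.
Proof. by move=> bf; rewrite RintegralZl //; exact: bounded_measurable_integrable. Qed.

Lemma RintegralB_bounded f g : bounded_measurable f -> bounded_measurable g ->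
  \int[P]_x (f x - g x) = \int[P]_x f x - \int[P]_x g x.
Proof. by move=> bf bg; rewrite RintegralB //; exact: bounded_measurable_integrable. Qed.

Lemma Rintegral_probability_cst a : \int[P]_x a = a.
Proof. by rewrite Rintegral_cst //= probability_setT mulr1. Qed.

Lemma Rintegral_sum_bounded I (r : seq I) (F : I -> T -> R) :
  (forall i, bounded_measurable (F i)) ->
  \int[P]_x (\sum_(i <- r) F i x) = \sum_(i <- r) \int[P]_x F i x.
Proof.
move=> bF; elim: r => [|i r IH].
  by under eq_Rintegral do rewrite big_nil; rewrite big_nil Rintegral_probability_cst.
under eq_Rintegral do rewrite big_cons.
by rewrite big_cons RintegralD_bounded ?IH //; exact: bounded_measurable_sum.
Qed.

Lemma le_Rintegral_bounded f g : bounded_measurable f -> bounded_measurable g ->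
  (forall x, f x <= g x) -> \int[P]_x f x <= \int[P]_x g x.
Proof.
by move=> bf bg fg; apply: le_Rintegral => //; exact: bounded_measurable_integrable.
Qed.

Lemma Rintegral_norm_le f e : bounded_measurable f -> (forall x, `|f x| <= e) ->
  `|\int[P]_x f x| <= e.
Proof.
move=> bf fe; rewrite ler_norml -{1}(Rintegral_probability_cst (- e)).
rewrite -{2}(Rintegral_probability_cst e).
apply/andP; split; apply: le_Rintegral_bounded => //; try exact: bounded_measurable_cst.
  by move=> x; move: (fe x); rewrite ler_norml => /andP[].
by move=> x; move: (fe x); rewrite ler_norml => /andP[].
Qed.

Lemma Rintegral_indicator (A : set T) : measurable A ->
  \int[P]_x (\1_A x : R) = fine (P A).
Proof. by move=> mA; rewrite /Rintegral integral_indic // setIT. Qed.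

(* The functions [f] satisfying the conclusion form a vector space which is
   closed under uniform limits; a function with values in [0, 1] is a uniform
   limit of averages of indicators of its superlevel sets. *)
Lemma Rintegral_factor_of_indicators d' (T' : measurableType d') (X : T -> T')
    (g : T -> R) (c : R) :
  measurable_fun setT X -> bounded_measurable g ->
  (forall A, measurable A -> \int[P]_w (\1_A (X w) * g w) = c * fine (P (X @^-1` A))) ->
  forall f : T' -> R, measurable_fun setT f -> (exists M, forall x, `|f x| <= M) ->
  \int[P]_w (f (X w) * g w) = c * \int[P]_w f (X w).
Proof.
move=> mX bg factor.
have bX (f : T' -> R) : measurable_fun setT f -> (exists M, forall x, `|f x| <= M) ->
    bounded_measurable (fun w => f (X w)) by exact: bounded_measurable_comp.
have b1 A : measurable A -> bounded_measurable (fun w => \1_A (X w) : R).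
  move=> mA; apply: bX; first exact: measurable_indic.
  by exists 1 => x; rewrite indicE; case: (_ \in _); rewrite ?normr1 ?normr0.
have unit_case (f : T' -> R) : measurable_fun setT f -> (forall x, 0 <= f x <= 1) ->
    \int[P]_w (f (X w) * g w) = c * \int[P]_w f (X w).
  move=> mf f01.
  have bf : bounded_measurable (fun w => f (X w)).
    by apply: bX => //; exists 1 => x; have /andP[? ?] := f01 x; rewrite ger0_norm.
  have [_ [N gN]] := bg.
  apply/eqP; rewrite -subr_eq0 -normr_le0; apply/ler_addgt0Pr => e e0; rewrite add0r.
  (* An error [|f - h| <= 1/m] costs at most [|N|/m] in the first integral and [|c|/m] in the
     second. *)
  pose m := (Num.truncn ((`|N| + `|c|) / e)).+1.
  have m0 : (0 : R) < m%:R by rewrite ltr0n.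
  pose A (j : 'I_m) : set T' := [set x | j.+1%:R <= m%:R * f x].
  have mA j : measurable (A j).
    rewrite /A -[X in measurable X]setTI; apply: measurable_fun_le => //.
    exact: measurable_funM.
  (* Exactly [Num.truncn (m f x)] of the level sets contain [x], so [h] rounds [f] down to a
     multiple of [1/m]. *)
  pose h x : R := m%:R^-1 * \sum_(j < m) \1_(A j) x.
  have hE x : h x = m%:R^-1 * (Num.truncn (m%:R * f x))%:R.
    have /andP[f0 f1] := f01 x.
    have tm : (Num.truncn (m%:R * f x) <= m)%N.
      by rewrite truncn_le_nat (le_lt_trans (ler_piMr (ltW m0) f1)) // ltr_nat.
    rewrite /h; congr (_ * _).
    have natE k : (k <= m)%N -> k%:R = \sum_(j < m | (j < k)%N) (1 : R).
      move=> km; rewrite -(@big_ord_widen R 0 +%R k m (fun=> 1) km).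
      by rewrite sumr_const card_ord.
    rewrite (natE _ tm) [RHS]big_mkcond /=; apply: eq_bigr => j _.
    by rewrite indicE truncn_gt_nat /A; case: ifPn => hj;
      [rewrite mem_set | rewrite memNset //=; exact/negP].
  have hf x : `|f x - h x| <= m%:R^-1.
    have /andP[f0 f1] := f01 x.
    have /truncn_itv /andP[lo up] : 0 <= m%:R * f x by rewrite mulr_ge0 ?ler0n.
    have -> : f x - h x = m%:R^-1 * (m%:R * f x - (Num.truncn (m%:R * f x))%:R).
      by rewrite hE mulrBr mulKf // gt_eqF.
    rewrite normrM ger0_norm ?invr_ge0 ?ler0n // ler_piMr ?invr_ge0 ?ler0n //.
    by rewrite ger0_norm ?subr_ge0 // lerBlDr nat1r ltW.
  have bh : bounded_measurable (fun w => h (X w)).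
    apply: bounded_measurableM; first exact: bounded_measurable_cst.
    by apply: bounded_measurable_sum => j; exact: b1.
  have h_case : \int[P]_w (h (X w) * g w) = c * \int[P]_w h (X w).
    transitivity (\int[P]_w (m%:R^-1 * \sum_(j < m) \1_(A j) (X w) * g w)).
      by apply: eq_Rintegral => w _; rewrite /h -mulr_suml mulrA.
    rewrite RintegralZ_bounded; last first.
      by apply: bounded_measurable_sum => j; apply: bounded_measurableM => //; exact: b1.
    rewrite Rintegral_sum_bounded; last by move=> j; apply: bounded_measurableM => //; exact: b1.
    rewrite /h RintegralZ_bounded; last by apply: bounded_measurable_sum => j; exact: b1.
    rewrite Rintegral_sum_bounded; last by move=> j; exact: b1.
    rewrite mulrCA; congr (_ * _); rewrite mulr_sumr; apply: eq_bigr => j _.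
    rewrite factor //; congr (_ * _); rewrite -Rintegral_indicator //.
    by rewrite -[X in measurable X]setTI; exact: mX.
  have -> : \int[P]_w (f (X w) * g w) - c * \int[P]_w f (X w) =
     \int[P]_w ((f (X w) - h (X w)) * g w) - c * \int[P]_w (f (X w) - h (X w)).
    have -> : \int[P]_w ((f (X w) - h (X w)) * g w) =
        \int[P]_w (f (X w) * g w) - \int[P]_w (h (X w) * g w).
      rewrite -RintegralB_bounded; try exact: bounded_measurableM.
      by apply: eq_Rintegral => w _; rewrite mulrBl.
    by rewrite RintegralB_bounded // h_case; ring.
  have bfh : bounded_measurable (fun w => f (X w) - h (X w)) by exact: bounded_measurableB.
  apply: le_trans (_ : (`|N| + `|c|) / m%:R <= e); last first.
    by rewrite ler_pdivrMr // mulrC -ler_pdivrMr // ltW // truncnS_gt.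
  rewrite (le_trans (ler_normB _ _)) // mulrDl lerD //.
    apply: Rintegral_norm_le; first exact: bounded_measurableM.
    move=> w; rewrite normrM mulrC ler_pM //; exact: le_trans (ler_norm _).
  by rewrite normrM ler_wpM2l //; apply: Rintegral_norm_le.
move=> f mf [M fM].
have M0 : 0 < `|M| + 1 by rewrite ltr_wpDl.
(* Affine rescaling to values in [0, 1]. The added one keeps the divisor positive; the additive
   constant is handled by [gE], the case of the full set. *)
pose f1 x := (2 * (`|M| + 1))^-1 * (f x + (`|M| + 1)).
have fE x : f x = 2 * (`|M| + 1) * f1 x - (`|M| + 1).
  by rewrite /f1 mulVKf ?addrK // mulf_neq0 // gt_eqF.
have mf1 : measurable_fun setT f1.
  by apply: measurable_funM => //; exact: measurable_funD.
have f101 x : 0 <= f1 x <= 1.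
  have : `|f x| <= `|M| + 1 by rewrite (le_trans (fM x)) // ler_wpDr // ler_norm.
  rewrite ler_norml => /andP[? ?]; rewrite /f1 mulrC ler_pdivlMr ?mulr_gt0 //.
  rewrite ler_pdivrMr ?mulr_gt0 // mul0r mul1r; apply/andP; split; lra.
have bf1 : bounded_measurable (fun w => f1 (X w)).
  by apply: bX => //; exists 1 => x; have /andP[? ?] := f101 x; rewrite ger0_norm.
clearbody f1.
have -> : \int[P]_w (f (X w) * g w) =
    \int[P]_w (2 * (`|M| + 1) * (f1 (X w) * g w) - (`|M| + 1) * g w).
  by apply: eq_Rintegral => w _; rewrite fE; ring.
have -> : \int[P]_w f (X w) = \int[P]_w (2 * (`|M| + 1) * f1 (X w) - (`|M| + 1)).
  by apply: eq_Rintegral => w _; rewrite fE.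
have gE : \int[P]_w g w = c.
  transitivity (\int[P]_w (\1_(setT : set T') (X w) * g w)).
    by apply: eq_Rintegral => w _; rewrite indicT mul1r.
  by rewrite factor // preimage_setT probability_setT mulr1.
have bc := bounded_measurable_cst.
have bfg : bounded_measurable (fun w => f1 (X w) * g w) by exact: bounded_measurableM.
rewrite !RintegralB_bounded ?RintegralZ_bounded //; try exact: bounded_measurableM.
by rewrite Rintegral_probability_cst unit_case // gE; ring.
Qed.

End BoundedMeasurable.

(** * Bounded complex-valued functions *)

Section ComplexIntegral.
Local Open Scope complex_scope.
Context {R : realType} {d : measure_display} {T : measurableType d}.
Local Notation C := R[i].

Definition cbounded_measurable (f : T -> C) :=
  bounded_measurable (fun x => complex.Re (f x)) /\
  bounded_measurable (fun x => complex.Im (f x)).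

Lemma cbounded_measurable_cst (a : C) : cbounded_measurable (fun=> a).
Proof. by split; exact: bounded_measurable_cst. Qed.

Lemma cImD (x y : C) : complex.Im (x + y) = complex.Im x + complex.Im y.
Proof. by case: x; case: y. Qed.

Lemma cReM (x y : C) :
  complex.Re (x * y) = complex.Re x * complex.Re y - complex.Im x * complex.Im y.
Proof. by case: x; case: y. Qed.

Lemma cImM (x y : C) :
  complex.Im (x * y) = complex.Re x * complex.Im y + complex.Im x * complex.Re y.
Proof. by case: x; case: y. Qed.

Lemma cbounded_measurableD f g : cbounded_measurable f -> cbounded_measurable g ->
  cbounded_measurable (fun x => f x + g x).
Proof.
move=> [rf jf] [rg jg]; split.
  by under eq_fun do rewrite cReD; exact: bounded_measurableD.
by under eq_fun do rewrite cImD; exact: bounded_measurableD.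
Qed.

Lemma cbounded_measurableM f g : cbounded_measurable f -> cbounded_measurable g ->
  cbounded_measurable (fun x => f x * g x).
Proof.
move=> [rf jf] [rg jg]; split.
  under eq_fun do rewrite cReM.
  by apply: bounded_measurableB; exact: bounded_measurableM.
under eq_fun do rewrite cImM.
by apply: bounded_measurableD; exact: bounded_measurableM.
Qed.

Lemma cbounded_measurable_sum I (r : seq I) (p : pred I) (F : I -> T -> C) :
  (forall i, cbounded_measurable (F i)) ->
  cbounded_measurable (fun x => \sum_(i <- r | p i) F i x).
Proof.
move=> bF; elim: r => [|i r IH].
  by under eq_fun do rewrite big_nil; exact: cbounded_measurable_cst.
under eq_fun do rewrite big_cons; case: (p i) => //.
exact: cbounded_measurableD.
Qed.

Lemma cbounded_measurable_prod I (r : seq I) (p : pred I) (F : I -> T -> C) :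
  (forall i, cbounded_measurable (F i)) ->
  cbounded_measurable (fun x => \prod_(i <- r | p i) F i x).
Proof.
move=> bF; elim: r => [|i r IH].
  by under eq_fun do rewrite big_nil; exact: cbounded_measurable_cst.
under eq_fun do rewrite big_cons; case: (p i) => //.
exact: cbounded_measurableM.
Qed.

Definition cindic (A : set T) (x : T) : C := (\1_A x : R)%:C%C.

Lemma cbounded_measurable_cindic A : measurable A -> cbounded_measurable (cindic A).
Proof.
by move=> mA; split; [exact: bounded_measurable_indic | exact: bounded_measurable_cst].
Qed.

Lemma cbounded_measurable_comp d' (T' : measurableType d') (X : T' -> T) f :
  measurable_fun setT X -> cbounded_measurable f ->
  [/\ measurable_fun setT (fun w => complex.Re (f (X w))),
      measurable_fun setT (fun w => complex.Im (f (X w))) &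
      exists M, forall w, `|complex.Re (f (X w))| <= M /\ `|complex.Im (f (X w))| <= M].
Proof.
move=> mX [[mr [M rM]] [mi [N iN]]]; split.
- exact: (measurableT_comp mr).
- exact: (measurableT_comp mi).
- by exists (Num.max M N) => w; split; rewrite le_max ?rM ?iN ?orbT.
Qed.

End ComplexIntegral.

(** * Complex expectations and their factorisation under independence *)

Section ComplexExpectation.
Local Open Scope complex_scope.
Context {R : realType} {d : measure_display} {T : measurableType d}.
Local Notation C := R[i].
Variable P : probability T R.

Definition cexpectation (f : T -> C) : C :=
  (\int[P]_w complex.Re (f w)) +i* (\int[P]_w complex.Im (f w)).

Lemma cexpectationD f g : cbounded_measurable f -> cbounded_measurable g ->
  cexpectation (fun w => f w + g w) = cexpectation f + cexpectation g.
Proof.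
move=> [rf jf] [rg jg]; rewrite /cexpectation.
under eq_Rintegral do rewrite cReD; under [in X in _ +i* X]eq_Rintegral do rewrite cImD.
by rewrite !RintegralD_bounded.
Qed.

Lemma cexpectationZ a f : cbounded_measurable f ->
  cexpectation (fun w => a * f w) = a * cexpectation f.
Proof.
move=> [rf jf]; rewrite /cexpectation.
have bc x : bounded_measurable (fun=> x : R) by exact: bounded_measurable_cst.
under eq_Rintegral do rewrite cReM; under [in X in _ +i* X]eq_Rintegral do rewrite cImM.
rewrite RintegralB_bounded; try exact: bounded_measurableM.
rewrite RintegralD_bounded; try exact: bounded_measurableM.
by rewrite !RintegralZ_bounded //; case: a.
Qed.

Lemma cexpectation_cst a : cexpectation (fun=> a) = a.
Proof. by rewrite /cexpectation !Rintegral_probability_cst; case: a. Qed.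

Lemma cexpectation_sum I (r : seq I) (p : pred I) (F : I -> T -> C) :
  (forall i, cbounded_measurable (F i)) ->
  cexpectation (fun x => \sum_(i <- r | p i) F i x) =
  \sum_(i <- r | p i) cexpectation (F i).
Proof.
move=> bF; elim: r => [|i r IH].
  by under eq_fun do rewrite big_nil; rewrite big_nil cexpectation_cst.
under eq_fun do rewrite big_cons; rewrite big_cons; case: (p i) => //.
by rewrite cexpectationD ?IH //; exact: cbounded_measurable_sum.
Qed.

Lemma cexpectation_cindic (A : set T) : measurable A ->
  cexpectation (cindic A) = (fine (P A))%:C%C.
Proof.
move=> mA; rewrite /cexpectation /cindic /= Rintegral_indicator //.
by rewrite Rintegral_probability_cst.
Qed.

Lemma Re_cexpectation f : complex.Re (cexpectation f) = \int[P]_w complex.Re (f w).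
Proof. by []. Qed.

(** Indicators are real, so the hypothesis splits into one for the real part of [g] and one for its
    imaginary part; the four real products of parts of [f] and [g] then factor separately. *)
Lemma cexpectation_factor_of_indicators d' (T' : measurableType d') (X : T -> T')
    (g : T -> C) (c : C) :
  measurable_fun setT X -> cbounded_measurable g ->
  (forall A, measurable A ->
     cexpectation (fun w => cindic A (X w) * g w) = c * (fine (P (X @^-1` A)))%:C%C) ->
  forall f : T' -> C, cbounded_measurable f ->
  cexpectation (fun w => f (X w) * g w) = c * cexpectation (fun w => f (X w)).
Proof.
move=> mX [rg jg] factor f [rf jf].
have factorR A : measurable A ->
    \int[P]_w (\1_A (X w) * complex.Re (g w)) = complex.Re c * fine (P (X @^-1` A)).
  move=> /factor /(congr1 (@complex.Re R)); rewrite cReM /= mulr0 subr0 => <-.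
  by apply: eq_Rintegral => w _; rewrite Re_realM.
have factorI A : measurable A ->
    \int[P]_w (\1_A (X w) * complex.Im (g w)) = complex.Im c * fine (P (X @^-1` A)).
  move=> /factor /(congr1 (@complex.Im R)); rewrite cImM /= mulr0 add0r => <-.
  by apply: eq_Rintegral => w _; rewrite cImM /= mul0r addr0.
have fR (h : T' -> R) (bh : bounded_measurable h) :=
  Rintegral_factor_of_indicators mX rg factorR bh.1 bh.2.
have fI (h : T' -> R) (bh : bounded_measurable h) :=
  Rintegral_factor_of_indicators mX jg factorI bh.1 bh.2.
have bX (h : T' -> R) : bounded_measurable h -> bounded_measurable (fun w => h (X w)).
  by move=> [? ?]; exact: bounded_measurable_comp.
have brX := bX _ rf; have biX := bX _ jf.
apply/eqP; rewrite eq_complex cReM cImM /=.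
under eq_Rintegral do rewrite cReM; under [X in _ && (X == _)]eq_Rintegral do rewrite cImM.
rewrite RintegralB_bounded; try exact: bounded_measurableM.
rewrite RintegralD_bounded; try exact: bounded_measurableM.
rewrite (fR _ rf) (fI _ rf) (fR _ jf) (fI _ jf).
by apply/andP; split; apply/eqP; ring.
Qed.

(* Induction on the number of factors which are not indicators. *)
Lemma cexpectation_prod_indep (I : finType) d' (T' : measurableType d')
    (X : I -> T -> T') :
  (forall i, measurable_fun setT (X i)) ->
  (forall B : I -> set T', (forall i, measurable (B i)) ->
     fine (P [set w | forall i, B i (X i w)]) = \prod_i fine (P (X i @^-1` B i))) ->
  forall F : I -> T' -> C, (forall i, cbounded_measurable (F i)) ->
  cexpectation (fun w => \prod_i F i (X i w)) = \prod_i cexpectation (fun w => F i (X i w)).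
Proof.
move=> mX indep.
have bX (h : T' -> C) i : cbounded_measurable h -> cbounded_measurable (fun w => h (X i w)).
  move=> /(cbounded_measurable_comp (mX i)) [mr mi [M hM]].
  by split; split=> //; exists M => w; have [] := hM w.
have mpre i A : measurable A -> measurable (X i @^-1` A).
  by move=> mA; rewrite -[X in measurable X]setTI; exact: mX.
suff main (s : seq I) : forall F : I -> T' -> C, (forall i, cbounded_measurable (F i)) ->
    (forall i, i \notin s -> exists2 A, measurable A & F i = cindic A) ->
    cexpectation (fun w => \prod_i F i (X i w)) =
    \prod_i cexpectation (fun w => F i (X i w)).
  by move=> F bF; apply: (main (index_enum I)) => // i; rewrite mem_index_enum.
elim: s => [|j s IH] F bF indF.
  have indA i : exists A, measurable A /\ F i = cindic A.
    by have [//|A mA FA] := indF i; exists A.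
  have [A AP] := choice indA.
  have mA i : measurable (A i) by have [] := AP i.
  have FE i : F i = cindic (A i) by have [] := AP i.
  (* When all factors are indicators, their product is the indicator of a box event, and the claim
     is the hypothesis on boxes. *)
  transitivity (cexpectation (cindic [set w | forall i, A i (X i w)])).
    congr cexpectation; apply/funext => w; rewrite /cindic indicE.
    have [/set_mem h|h] := boolP (w \in _).
      by apply: big1 => i _; rewrite FE /cindic indicE mem_set //=; exact: h.
    have [i hi] : exists i, ~ A i (X i w).
      by apply/existsNP => h'; move/negP: h; apply; rewrite inE.
    by rewrite (bigD1 i) //= FE /cindic indicE memNset // mul0r.
  have -> : [set w | forall i, A i (X i w)] = \bigcap_(i in setT) (X i @^-1` A i).
    by apply/seteqP; split => w h; [move=> i _; exact: h | move=> i; exact: h].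
  rewrite cexpectation_cindic; last first.
    by apply: fin_bigcap_measurable => // i _; exact: mpre.
  have -> : \bigcap_(i in setT) (X i @^-1` A i) = [set w | forall i, A i (X i w)].
    by apply/seteqP; split => w h; [move=> i; exact: h | move=> i _; exact: h].
  rewrite indep // rmorph_prod; apply: eq_bigr => i _.
  by rewrite FE; symmetry; apply: cexpectation_cindic; exact: mpre.
under eq_fun do rewrite (bigD1 j) //=; rewrite [RHS](bigD1 j) //= [RHS]mulrC.
pose g w := \prod_(i | i != j) F i (X i w).
apply: (@cexpectation_factor_of_indicators _ _ (X j) g) (mX j) _ _ _ (bF j) => //.
  by apply: cbounded_measurable_prod => i; exact: bX.
(* With an indicator in place of factor [j] the induction hypothesis for [s] applies; this is the
   factorisation against indicators that is required. *)
move=> A mA; pose F' i := if i == j then cindic A else F i.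
have F'j : F' j = cindic A by rewrite /F' eqxx.
have F'i i : i != j -> F' i = F i by rewrite /F' => /negbTE ->.
have bF' i : cbounded_measurable (F' i).
  by rewrite /F'; case: eqP => // _; exact: cbounded_measurable_cindic.
have indF' i : i \notin s -> exists2 B, measurable B & F' i = cindic B.
  move=> si; rewrite /F'; case: (eqVneq i j) => [_|ij]; first by exists A.
  by apply: indF; rewrite inE negb_or ij.
transitivity (cexpectation (fun w => \prod_i F' i (X i w))).
  congr cexpectation; apply/funext => w; rewrite (bigD1 j) //= F'j; congr (_ * _).
  by apply: eq_bigr => i ij; rewrite F'i.
rewrite (IH _ bF' indF') (bigD1 j) //= mulrC; congr (_ * _).
  by apply: eq_bigr => i ij; rewrite F'i.
by rewrite F'j; apply: cexpectation_cindic; exact: mpre.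
Qed.

End ComplexExpectation.

(** * Characters *)

Section Expi.
Local Open Scope complex_scope.
Context {R : realType}.
Local Notation C := R[i].

Definition expi (a : R) : C := cos a +i* sin a.

Lemma expiD a b : expi (a + b) = expi a * expi b.
Proof.
apply/eqP; rewrite eq_complex cReM cImM /= cosD sinD eqxx /=.
by apply/eqP; ring.
Qed.

Lemma expi0 : expi 0 = 1.
Proof. by rewrite /expi cos0 sin0. Qed.

Lemma expi_sum I (r : seq I) (p : pred I) (F : I -> R) :
  expi (\sum_(i <- r | p i) F i) = \prod_(i <- r | p i) expi (F i).
Proof. exact: (big_morph _ expiD expi0). Qed.

Lemma conj_expi a : Num.conj (expi a) = expi (- a).
Proof. by rewrite /expi cosN sinN. Qed.

Lemma expi_2pi_nat k : expi (2 * pi * k%:R) = 1.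
Proof.
elim: k => [|k IH]; first by rewrite mulr0 expi0.
rewrite -(natr1 k) mulrDr expiD IH mul1r mulr1 /expi.
by rewrite mulrC mulr_natr cos2pi sin2pi.
Qed.

Lemma expi_2pi_int (k : int) : expi (2 * pi * k%:~R) = 1.
Proof.
case: k => k; first exact: expi_2pi_nat.
by rewrite NegzE mulrNz mulrN -conj_expi expi_2pi_nat conjC1.
Qed.

Lemma cbounded_measurable_expi (a : R) : cbounded_measurable (fun x : R => expi (a * x)).
Proof.
have ma : measurable_fun setT (fun x : R => a * x) by exact: measurable_funM.
split; apply: (bounded_measurable_comp ma).
- by apply: continuous_measurable_fun; exact: continuous_cos.
- by exists 1 => x; rewrite cos_max.
- by apply: continuous_measurable_fun; exact: continuous_sin.
- by exists 1 => x; rewrite sin_max.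
Qed.

End Expi.

(** * Fourier coefficients of the uniform law on the unit interval *)

Section UniformLaw.
Local Open Scope complex_scope.
Context {R : realType} {d : measure_display} {T : measurableType d}.
Variable P : probability T R.
Variable X : T -> R.
Hypothesis mX : measurable_fun setT X.
Hypothesis uX : forall B : set R, measurable B ->
  P (X @^-1` B) = uniform_prob (@ltr01 R) B.

(** Nonnegativity of [f] serves the change of variables and the density formula; signed integrands
    are shifted by a constant where this is used. *)
Lemma Rintegral_uniform_FTC (f F : R -> R) :
  (forall x, 0 <= f x) -> continuous f -> (forall x : R, is_derive x (1 : R) F (f x)) ->
  \int[P]_w f (X w) = F 1 - F 0.
Proof.
move=> f0 cf dF.
have mf : measurable_fun setT f by exact: continuous_measurable_fun.
have cF : continuous F.
  move=> x; apply: differentiable_continuous; apply/derivable1_diffP.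
  by have [] := dF x.
rewrite /Rintegral.
have mX' : measurable_fun setT (X : T -> measurableTypeR R) by exact: mX.
pose X' : {RV P >-> measurableTypeR R} :=
  @mfun_Sub _ _ T (measurableTypeR R) X (mem_set mX').
transitivity (fine (\int[distribution P X']_y (EFin \o f) y)%E).
  by rewrite ge0_integral_distribution //; exact: measurableT_comp.
transitivity (fine (\int[uniform_prob (@ltr01 R)]_y (EFin \o f) y)%E).
  by congr fine; apply: eq_measure_integral => A mA _; exact: uX.
rewrite integral_uniform; [|exact: measurableT_comp|by move=> x; rewrite lee_fin].
rewrite (@continuous_FTC2 _ f F) ?ltr01 //; first by rewrite subr0 invr1 mul1e.
- exact: continuous_subspaceT.
- split; first by move=> x _; have [] := dF x.
  + exact/cvg_at_right_filter/cF.
  + exact/cvg_at_left_filter/cF.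
- by move=> x _; rewrite derive1E; have [_ ->] := dF x.
Qed.

Lemma cexpectation_expi_uniform (k : int) :
  cexpectation P (fun w => expi (2 * pi * k%:~R * X w)) = (k == 0)%:R.
Proof.
case: (eqVneq k 0) => [->|k0].
  under eq_fun do rewrite mulr0z mulr0 mul0r expi0.
  exact: cexpectation_cst.
set a := 2 * pi * k%:~R.
have a0 : a != 0.
  by rewrite !mulf_neq0 ?intr_eq0 // gt_eqF // pi_gt0.
have [b1 b2] : cbounded_measurable (fun w => expi (a * X w)).
  have [mr mi [M hM]] := cbounded_measurable_comp mX (cbounded_measurable_expi a).
  by split; split=> //; exists M => w; have [] := hM w.
have /(congr1 (fun z => (complex.Re z, complex.Im z))) [ca sa] := expi_2pi_int k : expi a = 1.
have cax : continuous (fun x : R => a * x).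
  by move=> x; apply: cvgM; [exact: cvg_cst | exact: cvg_id].
rewrite /cexpectation /expi /=; apply/eqP; rewrite eq_complex /=; apply/andP; split; apply/eqP.
(* The constant one makes the integrand nonnegative and adds one to both sides. The sine vanishes at
   both ends, since [a] is an integer multiple of 2 pi. *)
- have := @Rintegral_uniform_FTC (fun x => 1 + cos (a * x)) (fun x => x + sin (a * x) / a).
  rewrite RintegralD_bounded ?Rintegral_probability_cst; last 2 first.
  + exact: bounded_measurable_cst.
  + exact: b1.
  rewrite !mulr1 mulr0 sin0 sa mul0r !addr0 subr0 => H.
  apply: (addrI 1); rewrite addr0; apply: H.
  + by move=> x; have := cos_geN1 (a * x); lra.
  + move=> x; apply: cvgD; first exact: cvg_cst.
    by apply: continuous_comp; [exact: cax | exact: continuous_cos].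
  + move=> x; apply: is_derive_eq.
    by rewrite /GRing.scale /= ; field.
(* The same shift; here the cosine equals one at both ends, so its contributions cancel. *)
- have := @Rintegral_uniform_FTC (fun x => 1 + sin (a * x)) (fun x => x - cos (a * x) / a).
  rewrite RintegralD_bounded ?Rintegral_probability_cst; last 2 first.
  + exact: bounded_measurable_cst.
  + exact: b2.
  rewrite !mulr1 mulr0 cos0 ca add0r => H.
  apply: (addrI 1); rewrite addr0; transitivity (1 - 1 / a - - (1 / a)); last by ring.
  apply: H.
  + by move=> x; have := sin_geN1 (a * x); lra.
  + move=> x; apply: cvgD; first exact: cvg_cst.
    by apply: continuous_comp; [exact: cax | exact: continuous_sin].
  + move=> x; apply: is_derive_eq.
    by rewrite /GRing.scale /= ; field.
Qed.

End UniformLaw.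

Section Characters.
Local Open Scope complex_scope.
Context {R : realType}.

Lemma char_expE (d : nat) (k : 'rV[int]_d) (x : d.-tuple R) :
  char_exp k x = \prod_i expi (2 * pi * (k 0 i)%:~R * tnth x i).
Proof.
rewrite -expi_sum /char_exp /dotp -/(expi _); congr expi.
by rewrite mulr_sumr; apply: eq_bigr => i _; rewrite mulrA.
Qed.

Lemma char_expD d (k l : 'rV[int]_d) (x : d.-tuple R) :
  char_exp (k + l) x = char_exp k x * char_exp l x.
Proof.
rewrite !char_expE -big_split /=; apply: eq_bigr => i _.
by rewrite -expiD mxE intrD mulrDr mulrDl.
Qed.

Lemma char_exp0 d (x : d.-tuple R) : char_exp 0 x = 1.
Proof. by rewrite char_expE big1 // => i _; rewrite mxE mulr0 mul0r expi0. Qed.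

Lemma conj_char_exp d (k : 'rV[int]_d) (x : d.-tuple R) :
  Num.conj (char_exp k x) = char_exp (- k) x.
Proof.
rewrite !char_expE rmorph_prod; apply: eq_bigr => i _.
by rewrite [LHS]conj_expi mxE mulrNz mulrN mulNr.
Qed.

End Characters.

(** * Orthogonality of characters under the joint law of the points *)

Section Orthogonality.
Local Open Scope complex_scope.
Context {R : realType} {dO : measure_display} {Omega : measurableType dO}.
Variable P : probability Omega R.
Variables (d n : nat) (x : 'I_n -> {RV P >-> d.-tuple R}).
Hypothesis indep : mutually_independent P (fun t => x t).
Hypothesis unif : forall t : 'I_n, uniform_on_cube P (x t).

(** The [n] vectors are unfolded into [n d] scalar coordinates, which reduces every expectation to a
    one-dimensional integral. *)
Let X (p : 'I_n * 'I_d) (w : Omega) : R := tnth (x p.1 w) p.2.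

Let mX p : measurable_fun setT (X p).
Proof. by apply: (measurableT_comp (measurable_tnth p.2)); exact: measurable_funP. Qed.

Let uX p (B : set R) : measurable B -> P (X p @^-1` B) = uniform_prob (@ltr01 R) B.
Proof.
case: p => t i mB.
(* A box whose other sides are the whole line isolates coordinate [i]. *)
have := @unif t (fun j => if j == i then B else setT).
rewrite (bigD1 i) //= eqxx big1 ?mule1; last first.
  by move=> j /negbTE ->; exact: probability_setT.
move=> <-; last by move=> j; case: eqP.
congr (P _); apply/seteqP; split => w /=.
  by move=> h j; case: eqP => // ->.
by move=> /(_ i); rewrite eqxx.
Qed.

Let prodE (I : finType) (F : I -> R) : (\prod_i (F i)%:E)%E = (\prod_i F i)%:E.
Proof. by symmetry; apply: (big_morph EFin). Qed.

(** Independence of the vectors splits the event over [t], and the product form of the cube law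
    splits each factor over [i]. *)
Let boxes (B : 'I_n * 'I_d -> set R) : (forall p, measurable (B p)) ->
  fine (P [set w | forall p, B p (X p w)]) = \prod_p fine (P (X p @^-1` B p)).
Proof.
move=> mB.
pose Bt t : set (d.-tuple R) := [set y | forall i, B (t, i) (tnth y i)].
have mBt t : measurable (Bt t).
  have -> : Bt t = \bigcap_(i in setT) ((fun y => tnth y i) @^-1` B (t, i)).
    by apply/seteqP; split => y h; [move=> i _; exact: h | move=> i; exact: h].
  apply: fin_bigcap_measurable => // i _.
  by rewrite -[X in measurable X]setTI; exact: measurable_tnth.
have -> : [set w | forall p, B p (X p w)] =
    [set w | forall t, t \in [set: 'I_n]%SET -> Bt t (x t w)].
  apply/seteqP; split => w h; first by move=> t _ i; exact: (h (t, i)).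
  by move=> [t i]; apply: (h t); rewrite inE.
rewrite indep //.
have fin_u p : uniform_prob (@ltr01 R) (B p) = (fine (P (X p @^-1` B p)))%:E.
  rewrite -(uX p (mB p)) fineK // fin_num_measure //.
  by rewrite -[X in measurable X]setTI; exact: mX.
rewrite (eq_bigr (fun t => (\prod_i fine (P (X (t, i) @^-1` B (t, i))))%:E)); last first.
  move=> t _; rewrite -prodE.
  transitivity (\prod_(i < d) uniform_prob (@ltr01 R) (B (t, i)))%E.
    exact: (@unif t (fun i => B (t, i)) (fun i => mB _)).
  by apply: eq_bigr => i _; rewrite fin_u.
rewrite (eq_bigl xpredT); last by move=> t; rewrite inE.
rewrite prodE /= pair_bigA /=; apply: eq_bigr => -[t i] _ //.
Qed.

Lemma cbounded_measurable_char_exp (k : 'rV[int]_d) t :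
  cbounded_measurable (fun w => char_exp k (x t w)).
Proof.
under eq_fun do rewrite char_expE.
apply: cbounded_measurable_prod => i.
have [mr mi [M hM]] := cbounded_measurable_comp (mX (t, i))
  (cbounded_measurable_expi (2 * pi * (k 0 i)%:~R)).
by split; split=> //; exists M => w; have [] := hM w.
Qed.

(** A nonzero [K t] has a nonzero coordinate, and that one scalar factor already has expectation
    zero. *)
Lemma cexpectation_prod_char_exp (K : 'I_n -> 'rV[int]_d) :
  cexpectation P (fun w => \prod_t char_exp (K t) (x t w)) =
  [forall t, K t == 0]%:R.
Proof.
transitivity (cexpectation P
    (fun w => \prod_p expi (2 * pi * (K p.1 0 p.2)%:~R * X p w))).
  congr cexpectation; apply/funext => w.
  rewrite (eq_bigr _ (fun t _ => char_expE (K t) (x t w))) pair_bigA /=.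
  by apply: eq_bigr => -[t i].
rewrite (cexpectation_prod_indep mX boxes
   (F := fun p r => expi (2 * pi * (K p.1 0 p.2)%:~R * r))); last first.
  by move=> p; exact: cbounded_measurable_expi.
under eq_bigr do rewrite (cexpectation_expi_uniform (mX _) (uX _)).
case: forallP => [h|/forallP].
  by rewrite big1 // => -[t i] _ /=; rewrite (eqP (h t)) mxE eqxx.
rewrite negb_forall => /existsP [t /rV0Pn [i ki]].
by rewrite (bigD1 (t, i)) //= (negbTE ki) mul0r.
Qed.

End Orthogonality.

(** * Trigonometric polynomials in a subset of the points *)

Section TrigonometricPolynomials.
Local Open Scope complex_scope.
Context {R : realType} {dO : measure_display} {Omega : measurableType dO}.
Local Notation C := R[i].
Variable P : probability Omega R.
Variables (d n : nat) (x : 'I_n -> {RV P >-> d.-tuple R}).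

(** Dependence on the points with index in [J] alone is recorded by frequencies that vanish outside
    [J]; independence is then exploited through frequencies instead of sigma-algebras. *)
Inductive trig_poly (J : {set 'I_n}) : (Omega -> C) -> Prop :=
| TrigMonomial (a : C) (K : 'I_n -> 'rV[int]_d) :
    (forall t, t \notin J -> K t = 0) ->
    trig_poly J (fun w => a * \prod_t char_exp (K t) (x t w))
| TrigAdd f g : trig_poly J f -> trig_poly J g -> trig_poly J (fun w => f w + g w).

Lemma trig_poly_bounded J f : trig_poly J f -> cbounded_measurable f.
Proof.
elim=> [a K _|g h _ bg _ bh]; last exact: cbounded_measurableD.
apply: cbounded_measurableM; first exact: cbounded_measurable_cst.
by apply: cbounded_measurable_prod => t; exact: cbounded_measurable_char_exp.
Qed.

Lemma trig_poly_cst J a : trig_poly J (fun=> a).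
Proof.
have := @TrigMonomial J a (fun=> 0) (fun _ _ => erefl).
congr trig_poly; apply/funext => w.
by rewrite big1 ?mulr1 // => t _; rewrite char_exp0.
Qed.

Lemma trig_poly_char_exp (J : {set 'I_n}) k t : t \in J ->
  trig_poly J (fun w => char_exp k (x t w)).
Proof.
move=> tJ; have := @TrigMonomial J 1 (fun s => if s == t then k else 0).
move=> /(_ _)/wrap[|].
  by move=> s sJ; case: eqP => // st; rewrite -st (negbTE sJ) in tJ.
congr trig_poly; apply/funext => w; rewrite mul1r (bigD1 t) //= eqxx big1 ?mulr1 //.
by move=> s /negbTE ->; rewrite char_exp0.
Qed.

Lemma trig_polyM J f g : trig_poly J f -> trig_poly J g ->
  trig_poly J (fun w => f w * g w).
Proof.
move=> tf; elim: tf g => [a K hK|f1 f2 _ IH1 _ IH2] g tg; last first.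
  under eq_fun do rewrite mulrDl.
  by apply: TrigAdd; [exact: IH1 | exact: IH2].
elim: tg => [b L hL|g1 g2 _ IH1 _ IH2]; last first.
  by under eq_fun do rewrite mulrDr; exact: TrigAdd.
have := @TrigMonomial J (a * b) (fun t => K t + L t).
move=> /(_ _)/wrap[|]; first by move=> t tJ; rewrite hK ?hL ?addr0.
congr trig_poly; apply/funext => w; rewrite mulrACA -big_split /=; congr (_ * _).
by apply: eq_bigr => t _; rewrite char_expD.
Qed.

Lemma trig_poly_sum J I (r : seq I) (p : pred I) (F : I -> Omega -> C) :
  (forall i, p i -> trig_poly J (F i)) ->
  trig_poly J (fun w => \sum_(i <- r | p i) F i w).
Proof.
move=> tF; elim: r => [|i r IH].
  by under eq_fun do rewrite big_nil; exact: trig_poly_cst.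
under eq_fun do rewrite big_cons; have [pi|//] := boolP (p i).
by apply: TrigAdd => //; exact: tF.
Qed.

Hypothesis indep : mutually_independent P (fun t => x t).
Hypothesis unif : forall t : 'I_n, uniform_on_cube P (x t).

(** Monomials of [f] have frequency zero at [t], so those of the product have frequency [k != 0]
    there. *)
Lemma cexpectation_char_exp_mul (J : {set 'I_n}) f (k : 'rV[int]_d) t :
  t \notin J -> k != 0 -> trig_poly J f ->
  cexpectation P (fun w => char_exp k (x t w) * f w) = 0.
Proof.
move=> tJ k0; elim=> [a K hK|g h tg IHg th IHh]; last first.
  under eq_fun do rewrite mulrDr.
  rewrite cexpectationD ?IHg ?IHh ?addr0 //.
    by apply: cbounded_measurableM;
      [exact: cbounded_measurable_char_exp | exact: trig_poly_bounded tg].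
  by apply: cbounded_measurableM;
      [exact: cbounded_measurable_char_exp | exact: trig_poly_bounded th].
pose L s := if s == t then k else K s.
transitivity (cexpectation P (fun w => a * \prod_s char_exp (L s) (x s w))).
  congr cexpectation; apply/funext => w; rewrite mulrCA; congr (_ * _).
  rewrite (bigD1 t) //= [in RHS](bigD1 t) //= hK // char_exp0 mul1r /L eqxx.
  by congr (_ * _); apply: eq_bigr => s /negbTE ->.
rewrite cexpectationZ; last first.
  by apply: cbounded_measurable_prod => s; exact: cbounded_measurable_char_exp.
rewrite cexpectation_prod_char_exp //; case: forallP => [/(_ t)|]; last by rewrite mulr0.
by rewrite /L eqxx (negbTE k0).
Qed.

End TrigonometricPolynomials.

(** * Trace moments *)

Section CenteredMatrix.
Local Open Scope complex_scope.
Context {R : realType} {d D : nat}.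
Variable k : 'I_D -> 'rV[int]_d.

(** For the row [u] of characters, [conj(u_a) u_b] is the character of [k b - k a]; this is
    [u^* u - 1], with zero diagonal and pure characters off it. *)
Definition centered_mx (y : d.-tuple R) : 'M[R[i]]_D :=
  \matrix_(a, b) char_exp (k b - k a) y - 1%:M.

Lemma is_hermitian1 m : is_hermitian (1%:M : 'M[R[i]]_m).
Proof. by rewrite /is_hermitian /adjoint trmx1 map_mx1. Qed.

Lemma is_hermitian_centered_mx y : is_hermitian (centered_mx y).
Proof.
apply: is_hermitianB; last exact: is_hermitian1.
apply/matrixP => a b; rewrite !mxE.
by apply: etrans (conj_char_exp _ _) _; rewrite opprB.
Qed.

(** [Z = u^* u] satisfies [Z^2 = D Z], the entries of [u] having modulus one; the coefficients come
    from rewriting [(Z - 1)^2] in terms of [Z - 1]. *)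
Lemma centered_mx_sqr y : centered_mx y * centered_mx y =
  (D%:R - 2)%:C *: centered_mx y + ((D%:R - 1)%:C)%:M.
Proof.
rewrite /centered_mx; set Z := \matrix_(a, b) _.
have Z2 : Z *m Z = D%:R *: Z.
  apply/matrixP => a b; rewrite !mxE.
  under eq_bigr do rewrite !mxE -char_expD addrC subrKA.
  by rewrite sumr_const card_ord mulr_natl.
rewrite -mulmxE mulmxBl !mulmxBr Z2 !mulmx1 !mul1mx.
by apply/matrixP => a b; rewrite !mxE !rmorphB !rmorph_nat; case: eqP => _ /=;
  rewrite ?mulr1n ?mulr0n; ring.
Qed.

End CenteredMatrix.

Section Moments.
Local Open Scope complex_scope.
Context {R : realType} {dO : measure_display} {Omega : measurableType dO}.
Variable P : probability Omega R.
Variables (d n D : nat) (x : 'I_n -> {RV P >-> d.-tuple R}).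
Variable k : 'I_D -> 'rV[int]_d.
Hypothesis kI : injective k.

Let Y t w := centered_mx k (x t w).
Let S J w := partial_sum (fun t => Y t w) J.

Lemma trig_poly_centered_mx (J : {set 'I_n}) t a b : t \in J ->
  trig_poly x J (fun w => Y t w a b).
Proof.
move=> tJ; under eq_fun do rewrite !mxE.
apply: TrigAdd; last exact: trig_poly_cst.
exact: trig_poly_char_exp.
Qed.

Lemma trig_poly_partial_sumX J m a b : trig_poly x J (fun w => (S J w ^+ m) a b).
Proof.
elim: m a b => [|m IH] a b.
  by under eq_fun do rewrite expr0; exact: trig_poly_cst.
under eq_fun do rewrite exprS -mulmxE mxE.
apply: trig_poly_sum => c _; apply: trig_polyM => //.
under eq_fun do rewrite /S /partial_sum summxE.
by apply: trig_poly_sum => t tJ; exact: trig_poly_centered_mx.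
Qed.

Lemma bounded_measurable_retr (F : Omega -> 'M[R[i]]_D) J :
  (forall a b, trig_poly x J (fun w => F w a b)) ->
  bounded_measurable (fun w => retr (F w)).
Proof.
by move=> tF; have [] := trig_poly_bounded (trig_poly_sum (index_enum 'I_D)
   (p := predT) (fun a _ => tF a a)).
Qed.

Lemma bounded_measurable_retr_partial_sum J m :
  bounded_measurable (fun w => retr (S J w ^+ m)).
Proof. by apply: bounded_measurable_retr => a b; exact: trig_poly_partial_sumX. Qed.

Lemma trig_poly_mono (J J' : {set 'I_n}) f : J \subset J' ->
  trig_poly x J f -> trig_poly x J' f.
Proof.
move=> JJ'; elim=> [a K hK|g h _ tg _ th]; last exact: TrigAdd.
by apply: TrigMonomial => t tJ'; apply: hK; apply: contra tJ'; exact: (fintype.subsetP JJ').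
Qed.

Lemma bounded_measurable_retr_mul J t m :
  bounded_measurable (fun w => retr (Y t w * S J w ^+ m)).
Proof.
apply: (@bounded_measurable_retr _ [set: 'I_n]%SET) => a b.
under eq_fun do rewrite -mulmxE mxE.
apply: trig_poly_sum => c _; apply: trig_polyM; first exact: trig_poly_centered_mx.
exact: trig_poly_mono (finset.subsetT J) (trig_poly_partial_sumX J m c b).
Qed.

Hypothesis indep : mutually_independent P (fun t => x t).
Hypothesis unif : forall t : 'I_n, uniform_on_cube P (x t).

(** The diagonal of [Y t] vanishes identically. Off it stand characters of nonzero frequency at
    [x t], by injectivity of [k], while the power of [S J] does not involve [x t]. *)
Lemma Rintegral_retr_mul_eq0 (J : {set 'I_n}) t m : t \notin J ->
  \int[P]_w retr (Y t w * S J w ^+ m) = 0.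
Proof.
move=> tJ; rewrite /retr -(Re_cexpectation P (fun w => \tr (Y t w * S J w ^+ m))).
under eq_fun do rewrite /mxtrace; rewrite /=.
have tY a b : cbounded_measurable (fun w => Y t w a b * (S J w ^+ m) b a).
  apply: cbounded_measurableM.
    exact: trig_poly_bounded (trig_poly_centered_mx a b (finset.in_setT t)).
  exact: trig_poly_bounded (trig_poly_partial_sumX J m b a).
transitivity (complex.Re (cexpectation P
    (fun w => \sum_a \sum_b Y t w a b * (S J w ^+ m) b a))).
  congr (complex.Re (cexpectation _ _)); apply/funext => w.
  by apply: eq_bigr => a _; rewrite -mulmxE mxE.
rewrite cexpectation_sum; last by move=> a; exact: cbounded_measurable_sum.
rewrite big1 // => a _; rewrite cexpectation_sum // big1 // => b _.
case: (eqVneq a b) => [->|ab].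
  under eq_fun do rewrite !mxE subrr char_exp0 eqxx subrr mul0r.
  exact: cexpectation_cst.
under eq_fun do rewrite !mxE (negbTE ab) subr0.
apply: (cexpectation_char_exp_mul indep unif tJ) (trig_poly_partial_sumX J m b a).
by rewrite subr_eq0 (inj_eq kI) eq_sym.
Qed.

Lemma moment_recursion (J : {set 'I_n}) p (c := (p.*2.+1)%:R / 2 : R) :
  (\int[P]_w retr (S J w ^+ p.+1.*2)) / 2 <=
  ((c * (D%:R - 2)) ^+ 2 / 2 + c * (#|J|%:R * (D%:R - 1))) * \int[P]_w retr (S J w ^+ p.*2) +
  c * (D%:R - 1) * \sum_(i in J) \int[P]_w retr (S (J :\ i)%SET w ^+ p.*2).
Proof.
have bs J' m := bounded_measurable_retr_partial_sum J' m.
have by' J' t m := bounded_measurable_retr_mul J' t m.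
have bsum (F : 'I_n -> Omega -> R) : (forall t, bounded_measurable (F t)) ->
    bounded_measurable (fun w => \sum_(i in J) F i w).
  move=> bF; under eq_fun do rewrite big_mkcond /=.
  by apply: bounded_measurable_sum => i; case: (i \in J) => //; exact: bounded_measurable_cst.
have Isum (F : 'I_n -> Omega -> R) : (forall t, bounded_measurable (F t)) ->
    \int[P]_w (\sum_(i in J) F i w) = \sum_(i in J) \int[P]_w F i w.
  move=> bF; under eq_Rintegral do rewrite big_mkcond /=.
  rewrite Rintegral_sum_bounded; last first.
    by move=> i; case: (i \in J) => //; exact: bounded_measurable_cst.
  rewrite [RHS]big_mkcond /=; apply: eq_bigr => i _; case: (i \in J) => //.
  exact: Rintegral_probability_cst.
have bM a (f : Omega -> R) : bounded_measurable f -> bounded_measurable (fun w => a * f w).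
  by move=> bf; apply: bounded_measurableM => //; exact: bounded_measurable_cst.
have pointwise w := trace_recursion (fun t => is_hermitian_centered_mx k (x t w))
  (fun t => centered_mx_sqr k (x t w)) J p.
rewrite mulrC -(RintegralZ_bounded P 2^-1 (bs J p.+1.*2)).
pose g1 w := \sum_(i in J) retr (Y i w * S (J :\ i)%SET w ^+ p.*2.+1).
pose g2 w := \sum_(i in J) retr (Y i w * S (J :\ i)%SET w ^+ p.*2).
pose g3 w := retr (S J w ^+ p.*2).
pose g4 w := \sum_(i in J) retr (S (J :\ i)%SET w ^+ p.*2).
have b1 : bounded_measurable g1 by apply: bsum => i; exact: by'.
have b2 : bounded_measurable g2 by apply: bsum => i; exact: by'.
have b3 : bounded_measurable g3 by exact: bs.
have b4 : bounded_measurable g4 by apply: bsum => i; exact: bs.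
(* The index [i] is absent from [J :\ i]; this eliminates both [g1] and [g2]. *)
have zero m : \int[P]_w (\sum_(i in J) retr (Y i w * S (J :\ i)%SET w ^+ m)) = 0.
  rewrite (Isum (fun i w => retr (Y i w * S (J :\ i)%SET w ^+ m))) //.
  by apply: big1 => i _; apply: Rintegral_retr_mul_eq0; rewrite !inE eqxx.
rewrite -(Isum (fun i w => retr (S (J :\ i)%SET w ^+ p.*2)) (fun i => bs _ _)).
pose a2 := c * (D%:R - 2); pose a4 := c * (D%:R - 1).
pose a3 := a2 ^+ 2 / 2 + c * (#|J|%:R * (D%:R - 1)).
apply: (@le_trans _ _ (\int[P]_w (g1 w + a2 * g2 w + a3 * g3 w + a4 * g4 w))).
  apply: le_Rintegral_bounded; first exact: bM.
    apply: bounded_measurableD; last exact: bM.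
    by apply: bounded_measurableD; [apply: bounded_measurableD => //|]; exact: bM.
  by move=> w; rewrite [leLHS]mulrC; exact: pointwise.
rewrite RintegralD_bounded; [| |exact: bM]; last first.
  by apply: bounded_measurableD; [apply: bounded_measurableD => //|]; exact: bM.
rewrite RintegralD_bounded; [|by apply: bounded_measurableD => //; exact: bM|exact: bM].
rewrite RintegralD_bounded; [|by []|exact: bM].
by rewrite !RintegralZ_bounded // /g1 /g2 !zero mulr0 !add0r.
Qed.

(** [N] bounds all orders [p] that occur, so one constant [K] serves every step. The induction is
    uniform in [J] because the recursion passes to the sets [J :\ i]. *)
Lemma moment_le (N : nat) (J : {set 'I_n}) p : (p <= N)%N -> (0 < D)%N ->
  \int[P]_w retr (S J w ^+ p.*2) <=
  (N%:R ^+ 2 * D%:R ^+ 2 + 4 * N%:R * n%:R * D%:R) ^+ p * D%:R.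
Proof.
move=> pN D0; set K := _ + _.
have K0 : 0 <= K by rewrite addr_ge0 ?mulr_ge0 ?sqr_ge0.
elim: p J pN => [|p IH] J pN.
  under eq_Rintegral do rewrite expr0 /retr mxtrace1.
  rewrite Rintegral_probability_cst expr0 mul1r.
  by rewrite -(rmorph_nat (real_complex R)).
have := moment_recursion J p.
have aJ := IH J (ltnW pN).
have aJi : \sum_(i in J) \int[P]_w retr (S (J :\ i)%SET w ^+ p.*2) <=
    n%:R * (K ^+ p * D%:R).
  apply: (@le_trans _ _ (\sum_(i in J) K ^+ p * D%:R)).
    by apply: ler_sum => i _; exact: IH (ltnW pN).
  rewrite sumr_const -[leLHS]mulr_natl ler_wpM2r ?mulr_ge0 ?exprn_ge0 // ler_nat.
  by rewrite -[n in (_ <= n)%N]card_ord max_card.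
have Jn : #|J|%:R <= n%:R :> R by rewrite ler_nat -[n in (_ <= n)%N]card_ord max_card.
have D1 : 1 <= D%:R :> R by rewrite ler1n.
(* [(2p+1)/2 <= p+1 <= N], the step being from [p] to [p+1]. *)
have cN : p.*2.+1%:R / 2 <= N%:R :> R.
  by rewrite ler_pdivrMr // -natrM ler_nat muln2 (@leq_trans p.+1.*2) ?leq_double ?doubleS.
have c0 : 0 <= p.*2.+1%:R / 2 :> R by rewrite divr_ge0.
have A0 : 0 <= K ^+ p * D%:R by rewrite mulr_ge0 ?exprn_ge0.
have J0 : 0 <= #|J|%:R :> R by [].
rewrite exprS -[_ * _ * D%:R]mulrA.
move: (_ / 2 : R) cN c0 => c cN c0.
move: (\int[P]_w _) aJ => a aJ.
move: (\sum_(i in J) _) aJi => b aJi.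
move: (\int[P]_w _) => e.
move: (K ^+ p * D%:R) A0 aJ aJi => A A0 aJ aJi.
move: (#|J|%:R : R) J0 Jn => j J0 Jn.
rewrite /K; move: (D%:R : R) D1 => D' D1.
have n0 : 0 <= n%:R :> R by [].
move: (n%:R : R) aJi Jn n0 => n' aJi Jn n0.
move: (N%:R : R) cN => N' cN h.
(* [(D - 2)^2 <= D^2] for [D >= 1], including [D = 1], where [D - 2] is negative. *)
have s1 : (c * (D' - 2)) ^+ 2 <= N' ^+ 2 * D' ^+ 2.
  rewrite exprMn; apply: ler_pM; rewrite ?sqr_ge0 //.
    by rewrite lerXn2r ?nnegrE ?(le_trans c0).
  by rewrite -subr_ge0 subr_sqr mulr_ge0 //; lra.
have s2 : c * (j * (D' - 1)) <= N' * (n' * D').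
  by rewrite !ler_pM ?mulr_ge0 ?subr_ge0 //; lra.
have s3 : c * (D' - 1) * b <= N' * D' * (n' * A).
  apply: (@le_trans _ _ (c * (D' - 1) * (n' * A))).
    by rewrite ler_wpM2l ?mulr_ge0 ?subr_ge0.
  by rewrite ler_wpM2r ?mulr_ge0 // ler_pM ?subr_ge0 //; lra.
have s4 : ((c * (D' - 2)) ^+ 2 / 2 + c * (j * (D' - 1))) * a <=
    (N' ^+ 2 * D' ^+ 2 / 2 + N' * (n' * D')) * A.
  apply: (@le_trans _ _ (((c * (D' - 2)) ^+ 2 / 2 + c * (j * (D' - 1))) * A)).
    by rewrite ler_wpM2l // addr_ge0 ?divr_ge0 ?sqr_ge0 // !mulr_ge0 ?subr_ge0.
  by rewrite ler_wpM2r //; lra.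
(* Doubling undoes the half on the left; [s3] and the second part of [s4] then give [2 N n D] each,
   hence the 4 in [K]. *)
have -> : e = 2 * (e / 2) by field.
lra.
Qed.

End Moments.

(** * Tail bound and sample size *)

Section Tail.
Local Open Scope complex_scope.
Context {R : realType} {dO : measure_display} {Omega : measurableType dO}.
Variable P : probability Omega R.

Lemma measurable_lt_cst (f : Omega -> R) (e : R) : measurable_fun setT f ->
  measurable [set w | f w < e].
Proof.
move=> mf; have -> : [set w | f w < e] = ~` [set w | e <= f w].
  by apply/seteqP; split => w /=; rewrite ltNge => /negP.
apply: measurableC; rewrite -[X in measurable X]setTI.
exact: measurable_fun_le.
Qed.

Lemma markov_lt (f : Omega -> R) (e delta : R) : bounded_measurable f ->
  (forall w, 0 <= f w) -> 0 < e -> \int[P]_w f w <= delta * e ->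
  ((1 - delta)%:E <= P [set w | (f w < e)%R])%E.
Proof.
move=> bf f0 e0 fe; have mA := measurable_lt_cst e bf.1.
set A := [set w | _] in mA *.
have mAc : measurable (~` A) by exact: measurableC.
have : e * fine (P (~` A)) <= delta * e.
  rewrite -Rintegral_indicator // -RintegralZ_bounded; last exact: bounded_measurable_indic.
  apply: le_trans fe; apply: le_Rintegral_bounded => //.
    apply: bounded_measurableM; first exact: bounded_measurable_cst.
    exact: bounded_measurable_indic.
  move=> w; rewrite indicE; case: (boolP (w \in _)) => [/set_mem|_]; last by rewrite mulr0.
  by rewrite mulr1 /A /= => /negP; rewrite -leNgt.
rewrite mulrC ler_pM2r // probability_setC //.
have fA : P A \is a fin_num by exact: fin_num_measure.
by rewrite -(fineK fA) -EFinB /= lee_fin => ?; lra.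
Qed.

End Tail.

Section SampleSize.
Local Open Scope complex_scope.
Context {R : realType}.

Lemma expRN1_ge : 1 / 4 <= expR (-1) :> R.
Proof.
have h := expR_ge1Dx (- (1 / 2) : R).
have -> : (-1 : R) = - (1 / 2) * 2%:R by lra.
rewrite expRM_natr; apply: (@le_trans _ _ ((1 / 2) ^+ 2)); first by lra.
by rewrite lerXn2r ?nnegrE ?expR_ge0 //; lra.
Qed.

(** [e^(-1/2) >= 1/2] gives [e^(1/2) <= 2 <= 2/delta]. The bound lets constant and linear terms be
    dominated by the square of this logarithm. *)
Lemma ln_two_div_ge (delta : R) : 0 < delta < 1 -> 1 / 2 <= ln (2 / delta).
Proof.
move=> /andP[d0 d1]; have h := expR_ge1Dx (- (1 / 2) : R).
have e2 : expR (1 / 2) <= 2 :> R.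
  have := mulVr (unitf_gt0 (expR_gt0 (1 / 2 : R))); rewrite -expRN.
  have := expR_gt0 (1 / 2 : R); nra.
rewrite -[leLHS]expRK ler_ln ?posrE ?expR_gt0 ?divr_gt0 //.
by rewrite (le_trans e2) // ler_pdivlMr //; nra.
Qed.

(** [N.+1] is the order of the moment: the first condition will yield [K <= (n eps)^2 / 4], and the
    second absorbs the factor [D] left by the trace. *)
Lemma exists_exponent (D n : nat) (eps delta : R) (L := (12^-1)^-1 * eps^-1 * ln (2 / delta)) :
  (0 < D)%N -> 0 < eps < 1 -> 0 < delta < 1 ->
  L ^+ 2 * (Num.sqrt D%:R + Num.sqrt (D%:R * ln D%:R)) ^+ 2 <= n%:R ->
  exists N : nat, 20 * (N.+1)%:R * D%:R <= n%:R * eps ^+ 2 /\ (1 / 4) ^+ N.+1 * D%:R <= delta.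
Proof.
move=> D0 /andP[e0 e1] hdelta; have l2 := ln_two_div_ge hdelta.
have /andP[d0 d1] := hdelta; move=> hn.
have D1 : 1 <= D%:R :> R by rewrite ler1n.
have Dp : 0 < D%:R :> R by rewrite ltr0n.
have lD : 0 <= ln (D%:R : R) by exact: ln_ge0.
set ell := ln (2 / delta) in L l2 hn.
set lnD := ln _ in lD hn.
have lnE : ln (2 / delta * D%:R) = ell + lnD by rewrite lnM ?posrE ?divr_gt0.
(* The successor exceeds [ln (2 D / delta)], so that [exp(-(N+1)) D <= delta / 2]. *)
exists (Num.truncn (ell + lnD)).
have s0 : 0 <= ell + lnD by lra.
have /andP[tle tgt] := truncn_itv s0.
set N := Num.truncn _ in tle tgt *.
split.
  have sq : D%:R * (1 + lnD) <= (Num.sqrt D%:R + Num.sqrt (D%:R * lnD)) ^+ 2.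
    rewrite sqrrD !sqr_sqrtr ?mulr_ge0 ?(ltW Dp) // mulrDr mulr1 lerD2r lerDl.
    by rewrite mulrn_wge0 // mulr_ge0 ?sqrtr_ge0.
  have LE : L ^+ 2 * eps ^+ 2 = 144 * ell ^+ 2.
    by rewrite /L; field; rewrite gt_eqF.
  have l4 : 1 <= 4 * ell ^+ 2 by nra.
  have lnD4 : lnD <= 4 * ell ^+ 2 * lnD by rewrite ler_peMl.
  (* Since [ell >= 1/2], both [ell <= 2 ell^2] and [1 <= 4 ell^2] hold, whence 6 = 2 + 4. *)
  have hN : N.+1%:R <= 6 * ell ^+ 2 * (1 + lnD) by rewrite -(natr1 N); nra.
  have step : 144 * ell ^+ 2 * (D%:R * (1 + lnD)) <= n%:R * eps ^+ 2.
    apply: (@le_trans _ _ (L ^+ 2 * (Num.sqrt D%:R + Num.sqrt (D%:R * lnD)) ^+ 2 * eps ^+ 2)).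
      by rewrite [leRHS]mulrAC LE ler_wpM2l // mulr_ge0 ?sqr_ge0.
    by rewrite ler_wpM2r ?sqr_ge0.
  apply: le_trans step.
  apply: (@le_trans _ _ (20 * (6 * ell ^+ 2 * (1 + lnD)) * D%:R)).
    by rewrite ler_wpM2r ?(ltW Dp) // ler_wpM2l.
  have : 0 <= ell ^+ 2 * (D%:R * (1 + lnD)) by rewrite !mulr_ge0 ?sqr_ge0 ?(ltW Dp) //; lra.
  lra.
apply: (@le_trans _ _ (expR (- (ell + lnD)) * D%:R)).
  rewrite ler_wpM2r ?(ltW Dp) //.
  apply: (@le_trans _ _ (expR (-1) ^+ N.+1)).
    by rewrite lerXn2r ?nnegrE ?expR_ge0 ?expRN1_ge // divr_ge0.
  by rewrite -expRM_natl ler_expR mulrN1 lerN2 ltW.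
have pos : 0 < 2 / delta * D%:R by rewrite mulr_gt0 // divr_gt0.
rewrite expRN -lnE lnK ?posrE //.
have -> : (2 / delta * D%:R)^-1 * D%:R = delta / 2 by field; rewrite !gt_eqF.
lra.
Qed.

End SampleSize.

(** * The normalised Gram matrix and its expectation *)

Section NormalizedGram.
Local Open Scope complex_scope.
Context {R : realType} {d : nat}.
Variable Gamma : {fset 'rV[int]_d}.

Definition frequency (a : 'I_#|` Gamma|) : 'rV[int]_d := (enum_fset Gamma)`_a.

Lemma frequency_inj : injective frequency.
Proof.
move=> a b ab; apply/val_inj/eqP.
by rewrite -(nth_uniq 0 (ltn_ord a) (ltn_ord b) (fset_uniq Gamma)) -/(frequency a) ab.
Qed.

Lemma normalized_gramE n (x : 'I_n -> d.-tuple R) : (0 < n)%N ->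
  normalized_gram Gamma x =
  (n%:R)^-1 *: partial_sum (fun t => centered_mx frequency (x t)) [set: 'I_n]%SET + 1%:M.
Proof.
move=> n0; have nz : (n%:R : R[i]) != 0 by rewrite pnatr_eq0 -lt0n.
rewrite /partial_sum /normalized_gram /centered_mx sumrB sumr_const cardsT card_ord.
rewrite scalerBr -[1%:M *+ n]scaler_nat scalerA mulVf // scale1r subrK; congr (_ *: _).
apply/matrixP => a b; rewrite summxE mxE; apply: eq_big => [t|t _]; first by rewrite inE.
rewrite !mxE char_expD mulrC; congr (_ * _).
exact: conj_char_exp.
Qed.

End NormalizedGram.

Section ExpectedGram.
Context {R : realType} {dO : measure_display} {Omega : measurableType dO}.
Variable P : probability Omega R.
Variables (d n : nat) (x : 'I_n -> {RV P >-> d.-tuple R}).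
Variable Gamma : {fset 'rV[int]_d}.
Hypothesis indep : mutually_independent P (fun t => x t).
Hypothesis unif : forall t : 'I_n, uniform_on_cube P (x t).

Lemma expectation_mxE m p (A : Omega -> 'M[R[i]]_(m, p)) a b :
  expectation_mx P A a b = cexpectation P (fun w => A w a b).
Proof. by rewrite mxE unlock. Qed.

Lemma expectation_normalized_gram : (0 < n)%N ->
  expectation_mx P (fun w => normalized_gram Gamma (fun t => x t w)) = 1%:M.
Proof.
move=> n0; apply/matrixP => a b; rewrite expectation_mxE.
have tY t := trig_poly_centered_mx x (@frequency d Gamma) a b (finset.in_setT t).
pose S w := \sum_t centered_mx (@frequency d Gamma) (x t w) a b.
have bS : cbounded_measurable S.
  by apply: cbounded_measurable_sum => t; exact: trig_poly_bounded (tY t).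
transitivity (cexpectation P (fun w => (n%:R)^-1 * S w + (1%:M : 'M[R[i]]_(#|` Gamma|)) a b)).
  congr cexpectation; apply/funext => w; rewrite normalized_gramE // mxE; congr (_ + _).
  by rewrite mxE /partial_sum summxE; congr (_ * _); apply: eq_bigl => t; rewrite inE.
rewrite cexpectationD; [|by apply: cbounded_measurableM => //; exact: cbounded_measurable_cst
  |exact: cbounded_measurable_cst].
rewrite cexpectationZ // cexpectation_cst cexpectation_sum; last first.
  by move=> t; exact: trig_poly_bounded (tY t).
rewrite big1 ?mulr0 ?add0r // => t _.
case: (eqVneq a b) => [->|ab].
  under eq_fun do rewrite !mxE subrr char_exp0 eqxx subrr.
  exact: cexpectation_cst.
under eq_fun do rewrite !mxE (negbTE ab) subr0 -[char_exp _ _]mulr1.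
(* A single character is the case where the other factor is one and [J] is empty. *)
apply: (cexpectation_char_exp_mul indep unif (negbT (finset.in_set0 t))).
  by rewrite subr_eq0 (inj_eq (@frequency_inj _ _)) eq_sym.
exact: trig_poly_cst.
Qed.

End ExpectedGram.

Theorem corollary3p5 (R : realType) :
  exists c : R, 0 < c /\
  forall (d n : nat) (Gamma : {fset 'rV[int]_d})
         (dO : measure_display) (Omega : measurableType dO)
         (P : probability Omega R)
         (x : 'I_n -> {RV P >-> d.-tuple R})
         (eps delta : R),
    let D := #|` Gamma| in
    let L := c^-1 * eps^-1 * ln (2 / delta) in
    let lnD := ln (D%:R : R) in
    let G := fun w : Omega => normalized_gram Gamma (fun t => x t w) in
    let Q := expectation_mx P G in
    (1 <= d)%N ->
    Gamma != fset0 ->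
    (forall k : 'rV[int]_d, k \in Gamma -> - k \in Gamma) ->
    mutually_independent P (fun t => x t) ->
    (forall t : 'I_n, uniform_on_cube P (x t)) ->
    0 < eps < 1 ->
    0 < delta < 1 ->
    n%:R >= Num.max (D%:R : R)
             (Num.max (L * D%:R * lnD)
                      (L ^+ 2 * (Num.sqrt D%:R + Num.sqrt (D%:R * lnD)) ^+ 2)) ->
    let good := [set w | [/\ opnorm (G w - Q) < eps,
                             1 - eps < lambda_min (G w),
                             lambda_min (G w) <= lambda_max (G w) &
                             lambda_max (G w) < 1 + eps]] in
    ((1 - delta)%:E <= P good)%E.
Proof.
(* The square of 12 is what counts: [exists_exponent] consumes 20 * 6 = 120, and [L ^+ 2] provides
   144. *)
exists 12^-1; split; first by rewrite invr_gt0.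
move=> d n Gamma dO Omega P x eps delta D L lnD G Q d1 Gamma0 _ indep unif heps hdelta.
move=> hn; cbv zeta; set good := [set w | _]; move: hn; rewrite !ge_max => /and3P [nD _ nL].
have D0 : (0 < D)%N by rewrite cardfs_gt0.
have n0 : (0 < n)%N by rewrite (leq_trans D0) // -(ler_nat R).
have [N [Nn Ndelta]] := exists_exponent D0 heps hdelta nL.
have /andP[e0 e1] := heps; have /andP[de0 de1] := hdelta.
pose k := @frequency d Gamma.
pose S w := partial_sum (fun t => centered_mx k (x t w)) [set: 'I_n]%SET.
pose M w := G w - Q.
have QE : Q = 1%:M by exact: expectation_normalized_gram.
have MS w : M w = (n%:R^-1)%:C%C *: S w.
  rewrite /M QE /G normalized_gramE // addrK.
  by rewrite -(rmorph_nat (real_complex R)) -fmorphV.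
have GE w : G w = M w + 1%:M by rewrite /M QE subrK.
have hM w : is_hermitian (M w).
  rewrite MS; apply/is_hermitianZ/is_hermitian_partial_sum => t.
  exact: is_hermitian_centered_mx.
have MX w m : retr (M w ^+ m) = n%:R^-1 ^+ m * retr (S w ^+ m).
  rewrite MS -retrZ; congr retr; rewrite rmorphXn /=.
  elim: m => [|m IH]; first by rewrite !expr0 scale1r.
  by rewrite !exprS IH -!mulmxE -scalemxAl -scalemxAr scalerA.
have bM m : bounded_measurable (fun w => retr (M w ^+ m)).
  under eq_fun do rewrite MX; apply: bounded_measurableM.
    exact: bounded_measurable_cst.
  exact: bounded_measurable_retr_partial_sum.
(* A countable union of sublevel sets of measurable functions: this is what
   makes [good] measurable, since [P] is arbitrary on non-measurable sets. *)
have goodE : good = \bigcup_p [set w | retr (M w ^+ p.+1.*2) < eps ^+ p.+1.*2].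
  apply/seteqP; split => w.
    case=> Me _ _ _; have [p hp] := mxtrace_pow_lt_of_opnorm D0 (hM w) e0 Me.
    by exists p.
  move=> [p _ hp]; rewrite /good /= GE -/(M w).
  have -> : M w + 1%:M - Q = M w by rewrite QE addrK.
  exact: spectrum_near1 hp.
have mlt p : measurable [set w | retr (M w ^+ p.+1.*2) < eps ^+ p.+1.*2].
  by apply: measurable_lt_cst; exact: (bM _).1.
apply: (@le_trans _ _ (P [set w | retr (M w ^+ N.+1.*2) < eps ^+ N.+1.*2])); last first.
  apply: le_measure; rewrite ?inE //; first by rewrite goodE; exact: bigcup_measurable.
  by rewrite goodE => w hw; exists N.
apply: markov_lt => //; first by move=> w; exact: mxtrace_even_ge0.
  by rewrite exprn_gt0.
under eq_Rintegral do rewrite MX.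
rewrite RintegralZ_bounded; last exact: bounded_measurable_retr_partial_sum.
have := moment_le (@frequency_inj _ Gamma) indep unif [set: 'I_n]%SET (leqnn N.+1) D0.
set K := _ + _ => moment.
have nR : 0 < n%:R :> R by rewrite ltr0n.
rewrite exprVn ler_pdivrMl ?exprn_gt0 //; apply: le_trans moment _.
have NR : 0 <= N.+1%:R :> R by [].
have DR : 0 <= D%:R :> R by [].
(* As [(N+1) D <= n], the first term of [K] is at most [(N+1) D n], so [K <= 5 (N+1) D n]; the 20 in
   [exists_exponent] is 4 * 5. *)
have K_le : K <= (n%:R * eps) ^+ 2 * (1 / 4).
  have ND : N.+1%:R * D%:R <= n%:R :> R.
    have : n%:R * eps ^+ 2 <= n%:R by rewrite ler_piMr ?(ltW nR) // expr_le1 ?ltW.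
    have : 0 <= N.+1%:R * D%:R :> R by rewrite mulr_ge0.
    lra.
  have ND2 : (N.+1%:R * D%:R) * (N.+1%:R * D%:R) <= (N.+1%:R * D%:R) * n%:R :> R.
    by rewrite ler_wpM2l // mulr_ge0.
  have nN : n%:R * (20 * N.+1%:R * D%:R) <= n%:R * (n%:R * eps ^+ 2).
    by rewrite ler_wpM2l // ltW.
  rewrite /K; lra.
have K0 : 0 <= K by rewrite /K addr_ge0 ?mulr_ge0 ?sqr_ge0.
(* The factors [(n eps)^(2N+2)] cancel, leaving [(1/4)^(N+1) D <= delta]. *)
apply: (@le_trans _ _ (((n%:R * eps) ^+ 2 * (1 / 4)) ^+ N.+1 * D%:R)).
  by rewrite ler_wpM2r // lerXn2r ?nnegrE // (le_trans K0).
have -> : n%:R ^+ N.+1.*2 * (delta * eps ^+ N.+1.*2) =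
    (n%:R * eps) ^+ N.+1.*2 * delta by rewrite [delta * _]mulrC mulrA exprMn.
rewrite exprMn -exprM mul2n -[leLHS]mulrA ler_wpM2l // exprn_ge0 //.
by rewrite mulr_ge0 // ltW.
Qed.
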